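(* Let $A$ be a Noetherian local ring with maximal ideal $\mathfrak{m}$ and residue field $k=A/\mathfrak{m}$, and let $M$ be a finitely generated $A$-module of dimension $1$. Set $W=\mathrm{H}^0_{\mathfrak{m}}(M)$. Then there is an integer $\ell$ such that the index of reducibility on $M$ of any parameter ideal $\mathfrak{q}$ for $M$ with $\mathfrak{q}\subseteq\mathfrak{m}^{\ell}$ is independent of $\mathfrak{q}$ and is given by $$\mathrm{N}_A(\mathfrak{q};M)=\mathfrak{S}(M)+\mathrm{r}_A(M/W).$$ Moreover, when $M=A$ and $k$ is infinite, the integer $\ell$ may be taken to be $$\ell=\max\{c,d\}+1,$$ where $c=\mathrm{red}(\mathfrak{m})$ is the reduction number of $\mathfrak{m}$ and $d$ is the smallest (nonnegative) integer with $\mathfrak{m}^d\cap W=0$.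
   Context: Let $(A,\mathfrak{m})$ be a Noetherian local ring with residue field $k=A/\mathfrak{m}$ and $M$ a finitely generated $A$-module. An ideal $I$ of $A$ is cofinite on $M$ if $M/IM$ has finite length. A parameter ideal for $M$ is a (proper) ideal of $A$ that is cofinite on $M$ and is generated by $\dim M$ elements (the smallest possible number). A submodule of $M$ is irreducible if it cannot be written as the intersection of two strictly larger submodules. If $I$ is cofinite on $M$, the index of reducibility $\mathrm{N}_A(I;M)$ is the number of submodules appearing in an irredundant expression of $IM$ as an intersection of irreducible submodules of $M$ (this number does not depend on the expression; it equals $\dim_k \mathrm{Hom}_A(k,M/IM)$). $\mathrm{H}^0_{\mathfrak{m}}(M)$ is the zeroth local cohomology module of $M$, i.e. the submodule of elements killed by some power of $\mathfrak{m}$. The socle dimension is $\mathfrak{S}(M)=\dim_k \mathrm{Hom}_A(k,M)$. The type of a finitely generated module $N$ of depth $t$ is $\mathrm{r}_A(N)=\dim_k \mathrm{Ext}^t_A(k,N)$. An ideal $J\subseteq I$ is a reduction of the ideal $I$ if $I^{n+1}=JI^n$ for some integer $n\ge 0$ (with $I^0=A$); it is a minimal reduction if no reduction of $I$ is properly contained in $J$. The reduction number of $I$ with respect to $J$ is $\mathrm{red}_J(I)=\min\{n: I^{n+1}=JI^n\}$, and the reduction number of $I$ is $\mathrm{red}(I)=\min\{\mathrm{red}_J(I): J \text{ is a minimal reduction of } I\}$. *)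

(* Defs.v *)
From HB Require Import structures.
From mathcomp Require Import all_boot all_order all_algebra ring_quotient.
From mathcomp Require Import boolp classical_sets functions cardinality.
From mathcomp.multinomials Require Import freeg.

Set Implicit Arguments.
Unset Strict Implicit.
Unset Printing Implicit Defensive.

Import GRing.Theory.
Local Open Scope ring_scope.

(* Submodules are boolean predicates with a [submodClosed] structure; since
   every proposition is reflected by a boolean ([boolp.asbool]), these are all
   the submodules.  Two submodules are equal when [N1 =i N2].                 *)
Notation ideal A := (submodClosed A^o).

(* 0 when P is empty; likewise for the uses of [xget 0%N] below, where the set
   has at most one element in the situations of interest.                     *)
Definition least (P : nat -> Prop) : nat :=
  xget 0%N [set n | P n /\ forall k, P k -> (n <= k)%N]%classic.

Section Submodules.
Variables (A : comNzRingType) (V : lmodType A).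

Definition strict_sub (N1 N2 : submodClosed V) : Prop :=
  {subset N1 <= N2} /\ exists2 x, x \in N2 & x \notin N1.

Definition full_pred : {pred V} := predT.
Fact full_closed : subsemimod_closed full_pred. Proof. by split; [split|]. Qed.
HB.instance Definition _ := GRing.isSubmodClosed.Build A V full_pred full_closed.
Definition full : submodClosed V := full_pred.

Definition span_pred (s : seq V) : {pred V} :=
  fun x => `[< exists a : 'I_(size s) -> A, x = \sum_i a i *: s`_i >].
Fact span_closed s : subsemimod_closed (span_pred s).
Proof.
split; first split.
- apply/asboolP; exists (fun=> 0).
  by rewrite big1 // => i _; rewrite scale0r.
- move=> _ _ /asboolP[a ->] /asboolP[b ->]; apply/asboolP.
  exists (fun i => a i + b i); rewrite -big_split /=.
  by apply: eq_bigr => i _; rewrite scalerDl.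
- move=> c _ /asboolP[a ->]; apply/asboolP; exists (fun i => c * a i).
  by rewrite scaler_sumr; apply: eq_bigr => i _; rewrite scalerA.
Qed.
HB.instance Definition _ s :=
  GRing.isSubmodClosed.Build A V (span_pred s) (span_closed s).
Definition span (s : seq V) : submodClosed V := span_pred s.

Definition mulmod_pred (I : ideal A) (N : submodClosed V) : {pred V} :=
  fun x => `[< exists n (a : 'I_n -> A) (y : 'I_n -> V),
    [/\ forall i, a i \in I, forall i, y i \in N & x = \sum_i a i *: y i] >].
Fact mulmod_closed I N : subsemimod_closed (mulmod_pred I N).
Proof.
split; first split.
- apply/asboolP; exists 0%N, (fun=> 0), (fun=> 0); split=> [[]//|[]//|].
  by rewrite big_ord0.
- move=> _ _ /asboolP[n [a [y [aI yN ->]]]] /asboolP[p [b [z [bI zN ->]]]].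
  apply/asboolP; exists (n + p)%N.
  exists (fun i : 'I_(n + p) =>
    match fintype.split i with inl j => a j | inr j => b j end).
  exists (fun i : 'I_(n + p) =>
    match fintype.split i with inl j => y j | inr j => z j end).
  split=> [i|i|]; try by case: fintype.split.
  rewrite big_split_ord /=; congr (_ + _); apply: eq_bigr => i _.
    by rewrite (unsplitK (inl i)).
  by rewrite (unsplitK (inr i)).
- move=> c _ /asboolP[n [a [y [aI yN ->]]]]; apply/asboolP.
  exists n, a, (fun i => c *: y i); split=> // [i|]; first exact: rpredZ.
  rewrite scaler_sumr; apply: eq_bigr => i _.
  by rewrite !scalerA mulrC.
Qed.
HB.instance Definition _ I N :=
  GRing.isSubmodClosed.Build A V (mulmod_pred I N) (mulmod_closed I N).
Definition mulmod (I : ideal A) (N : submodClosed V) : submodClosed V :=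
  mulmod_pred I N.

End Submodules.

Arguments full {A} V.

Section SubquotientModules.
Variables (A : comNzRingType) (V : lmodType A) (N : submodClosed V).

Definition submod_type := {x : V | x \in N}.
HB.instance Definition _ := SubChoice.on submod_type.
HB.instance Definition _ := [SubChoice_isSubLmodule of submod_type by <:].

Definition submod : lmodType A := submod_type.
Definition submod_val (x : submod) : V := sval x.

Fact submod_val_in (x : submod) : submod_val x \in N.
Proof. exact: valP. Qed.

Fact submod_val_inj : injective submod_val.
Proof. exact: val_inj. Qed.

Fact submod_val0 : submod_val 0 = 0.
Proof. exact: (raddf0 (val : submod_type -> V)). Qed.

Fact submod_valD (x y : submod) :
  submod_val (x + y) = submod_val x + submod_val y.
Proof. exact: (raddfD (val : submod_type -> V)). Qed.

Fact submod_valZ a (x : submod) : submod_val (a *: x) = a *: submod_val x.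
Proof. by rewrite /submod_val -[LHS]/(val (a *: (x : submod_type))) linearZ. Qed.

(* [submodClosed] does not record closure under opposite, which
   [Quotient.quot] needs. *)
Definition quotmod_pred : {pred V} := fun x => x \in N.
HB.instance Definition _ :=
  GRing.isSubmodClosed.Build A V quotmod_pred (GRing.subsemimodClosedP N).

Definition quotmod_type := Quotient.quot quotmod_pred.
HB.instance Definition _ := GRing.Zmodule.on quotmod_type.

Definition qpi (x : V) : quotmod_type := (\pi_(Quotient.quot quotmod_pred) x)%qT.
Definition quotmod_scale (a : A) (x : quotmod_type) : quotmod_type :=
  qpi (a *: repr x).

Fact qpiP (x y : V) :
  reflect (qpi x = qpi y) (x - y \in N).
Proof. by rewrite -[_ \in N]/(_ \in quotmod_pred) Quotient.idealrBE; apply: eqP. Qed.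

Fact qpi_surj (x : quotmod_type) : exists y, x = qpi y.
Proof. by exists (repr x); rewrite /qpi reprK. Qed.

Fact qpiD (x y : V) :
  qpi (x + y) = qpi x + qpi y.
Proof. by rewrite /qpi piE. Qed.

Fact qpiZ a (x : V) :
  quotmod_scale a (qpi x) = qpi (a *: x).
Proof.
apply/qpiP; rewrite -scalerBr; apply: rpredZ.
by apply/qpiP; rewrite /qpi reprK.
Qed.

Fact quotmod_scaleA a b x :
  quotmod_scale a (quotmod_scale b x) = quotmod_scale (a * b) x.
Proof.
by have [y ->] := qpi_surj x; rewrite !qpiZ scalerA.
Qed.

Fact quotmod_scale1 : left_id 1 quotmod_scale.
Proof.
by move=> x; have [y ->] := qpi_surj x; rewrite qpiZ scale1r.
Qed.

Fact quotmod_scaleDr : right_distributive quotmod_scale +%R.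
Proof.
move=> a x y; have [u ->] := qpi_surj x.
have [v ->] := qpi_surj y.
by rewrite -qpiD !qpiZ -qpiD scalerDr.
Qed.

Fact quotmod_scaleDl x :
  {morph quotmod_scale^~ x : a b / a + b}.
Proof.
move=> a b; have [u ->] := qpi_surj x.
by rewrite !qpiZ -qpiD scalerDl.
Qed.

HB.instance Definition _ := GRing.Zmodule_isLmodule.Build A quotmod_type
  quotmod_scaleA quotmod_scale1 quotmod_scaleDr quotmod_scaleDl.

Definition quotmod : lmodType A := quotmod_type.
Definition quotmod_pi (x : V) : quotmod := qpi x.

Fact quotmod_piP (x y : V) :
  reflect (quotmod_pi x = quotmod_pi y) (x - y \in N).
Proof. exact: qpiP. Qed.

Fact quotmod_pi_surj (x : quotmod) : exists y, x = quotmod_pi y.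
Proof. exact: qpi_surj. Qed.

Fact quotmod_piD (x y : V) :
  quotmod_pi (x + y) = quotmod_pi x + quotmod_pi y.
Proof. exact: qpiD. Qed.

Fact quotmod_piZ a (x : V) : quotmod_pi (a *: x) = a *: quotmod_pi x.
Proof. exact/esym/qpiZ. Qed.

End SubquotientModules.

Section Hom.
Variables (A : comNzRingType) (U V : lmodType A).

Definition hom_pred : {pred U -> V} := fun f => `[< linear f >].
Fact hom_closed : subsemimod_closed hom_pred.
Proof.
split; first split.
- by apply/asboolP => a u v; rewrite scaler0 addr0.
- move=> f g /asboolP lf /asboolP lg; apply/asboolP => a u v.
  have E w : (f + g) w = f w + g w by [].
  by rewrite !E lf lg scalerDr addrACA.
- move=> c f /asboolP lf; apply/asboolP => a u v.
  have E w : (c *: f) w = c *: f w by [].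
  by rewrite !E lf scalerDr !scalerA mulrC.
Qed.
HB.instance Definition _ :=
  GRing.isSubmodClosed.Build A (U -> V) hom_pred hom_closed.

Definition hom : lmodType A := submod (hom_pred : submodClosed (U -> V)).

Definition hom_app (f : hom) : U -> V := submod_val f.

Fact hom_appD (f g : hom) u : hom_app (f + g) u = hom_app f u + hom_app g u.
Proof. by rewrite /hom_app submod_valD. Qed.

Fact hom_appZ a (f : hom) u : hom_app (a *: f) u = a *: hom_app f u.
Proof. by rewrite /hom_app submod_valZ. Qed.

Fact hom_app0 u : hom_app 0 u = 0.
Proof. by rewrite /hom_app submod_val0. Qed.

End Hom.

(* The standard free resolution of X: [syzygy 0 = X], the module in degree i is
   free on the elements of [syzygy i], and [syzygy i.+1] is the kernel of the
   evaluation map of that free module onto [syzygy i].                        *)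
Section FreeResolution.
Variable A : comNzRingType.

Section EvalFree.
Variable X : lmodType A.

Definition eval_free : {freeg X / A} -> X := fglift id.

Fact eval_free_zmod : zmod_morphism eval_free.
Proof. exact: lift_is_additive. Qed.
HB.instance Definition _ :=
  GRing.isZmodMorphism.Build {freeg X / A} X eval_free eval_free_zmod.

Fact eval_free_scale : scalable eval_free.
Proof.
move=> a u; have evalU c x : eval_free << c *g x >> = c *: x by apply: liftU.
have -> : eval_free u = \sum_(x <- dom u) coeff x u *: x.
  rewrite -{1}(freeg_sumE u) (raddf_sum eval_free).
  by apply: eq_bigr => x _; apply: evalU.
rewrite [a *: u]/(fgscale a u) /fgscale (raddf_sum eval_free) scaler_sumr.
by apply: eq_bigr => x _; rewrite [LHS]evalU scalerA.
Qed.
HB.instance Definition _ :=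
  GRing.isScalable.Build A {freeg X / A} X *:%R eval_free eval_free_scale.

Definition ker_eval_pred : {pred {freeg X / A}} := fun u => eval_free u == 0.
Fact ker_eval_closed : subsemimod_closed ker_eval_pred.
Proof.
split; first split.
- by apply/eqP; rewrite raddf0.
- by move=> u v /eqP u0 /eqP v0; apply/eqP; rewrite (raddfD eval_free) /= u0 v0 addr0.
- by move=> a u /eqP u0; apply/eqP; rewrite eval_free_scale u0 scaler0.
Qed.
HB.instance Definition _ :=
  GRing.isSubmodClosed.Build A {freeg X / A} ker_eval_pred ker_eval_closed.

End EvalFree.

Variable X : lmodType A.

Fixpoint syzygy (i : nat) : lmodType A :=
  if i is j.+1 then
    submod (@ker_eval_pred (syzygy j) : submodClosed {freeg (syzygy j) / A})
  else X.

Definition resol (i : nat) : lmodType A := {freeg (syzygy i) / A}.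

Definition resol_diff (i : nat) (u : resol i.+1) : resol i :=
  submod_val (eval_free u : syzygy i.+1).

End FreeResolution.

Section Cohomology.
Variables (A : comNzRingType) (F0 F1 F2 N : lmodType A).
Variables (d1 : F1 -> F0) (d2 : F2 -> F1).

Definition cocycle_pred : {pred hom F1 N} :=
  fun f => `[< forall u : F2, hom_app f (d2 u) = 0 >].
Fact cocycle_closed : subsemimod_closed cocycle_pred.
Proof.
split; first split.
- by apply/asboolP => u; apply: hom_app0.
- move=> f g /asboolP f0 /asboolP g0; apply/asboolP => u.
  by rewrite hom_appD f0 g0 addr0.
- move=> a f /asboolP f0; apply/asboolP => u.
  by rewrite hom_appZ f0 scaler0.
Qed.
HB.instance Definition _ :=
  GRing.isSubmodClosed.Build A (hom F1 N) cocycle_pred cocycle_closed.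
Definition cocycle : lmodType A :=
  submod (cocycle_pred : submodClosed (hom F1 N)).

Definition cocycle_val (f : cocycle) : hom F1 N := submod_val f.

Fact cocycle_val0 : cocycle_val 0 = 0.
Proof. exact: submod_val0. Qed.

Fact cocycle_valD (f g : cocycle) :
  cocycle_val (f + g) = cocycle_val f + cocycle_val g.
Proof. exact: submod_valD. Qed.

Fact cocycle_valZ a (f : cocycle) :
  cocycle_val (a *: f) = a *: cocycle_val f.
Proof. exact: submod_valZ. Qed.

Definition coboundary_pred : {pred cocycle} :=
  fun f => `[< exists g : hom F0 N,
    forall u : F1, hom_app (cocycle_val f) u = hom_app g (d1 u) >].
Fact coboundary_closed : subsemimod_closed coboundary_pred.
Proof.
split; first split.
- by apply/asboolP; exists 0 => u; rewrite cocycle_val0 !hom_app0.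
- move=> f f' /asboolP[g fg] /asboolP[g' fg']; apply/asboolP.
  by exists (g + g') => u; rewrite cocycle_valD !hom_appD fg fg'.
- move=> a f /asboolP[g fg]; apply/asboolP; exists (a *: g) => u.
  by rewrite cocycle_valZ !hom_appZ fg.
Qed.
HB.instance Definition _ := GRing.isSubmodClosed.Build A cocycle
  coboundary_pred coboundary_closed.
Definition cohomology : lmodType A :=
  quotmod (coboundary_pred : submodClosed cocycle).

End Cohomology.

(* Ext^i(X, N) is the cohomology in degree i of the complex Hom(resol X, N).  *)
Definition Ext (A : comNzRingType) (X N : lmodType A) (i : nat) : lmodType A :=
  if i is j.+1
  then cohomology N (@resol_diff A X j) (@resol_diff A X j.+1)
  else cocycle N (@resol_diff A X 0).

Section Ideals.
Variable A : comNzRingType.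

Definition noetherian : Prop :=
  forall I : ideal A, exists s : seq A^o, I =i span s.

Definition proper (I : ideal A) : Prop := (1 : A) \notin I.

Definition maximal_ideal (m : ideal A) : Prop :=
  proper m /\
  forall I : ideal A, proper I -> {subset m <= I} -> I =i m.

Definition local_ring (m : ideal A) : Prop :=
  maximal_ideal m /\ forall I : ideal A, maximal_ideal I -> I =i m.

Definition prime_ideal (P : ideal A) : Prop :=
  proper P /\ prime_idealr_closed (P : {pred A}).

Fixpoint ideal_pow (I : ideal A) (n : nat) : ideal A :=
  if n is k.+1 then mulmod I (ideal_pow I k) else full A^o.

Definition power_relation (J I : ideal A) (n : nat) : Prop :=
  ideal_pow I n.+1 =i mulmod J (ideal_pow I n).

Definition reduction (J I : ideal A) : Prop :=
  {subset J <= I} /\ exists n, power_relation J I n.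

Definition minimal_reduction (J I : ideal A) : Prop :=
  reduction J I /\
  forall J' : ideal A, reduction J' I -> {subset J' <= J} -> J' =i J.

Definition red_wrt (J I : ideal A) : nat := least (power_relation J I).

Definition red (I : ideal A) : nat :=
  least (fun n => exists2 J, minimal_reduction J I & red_wrt J I = n).

End Ideals.

Section Modules.
Variables (A : comNzRingType) (V : lmodType A).

Definition finitely_generated : Prop := exists s : seq V, full V =i span s.

Definition prime_chain (l : nat) : Prop :=
  exists P : nat -> ideal A,
    [/\ forall i, (i <= l)%N -> prime_ideal (P i),
        forall a : A, (forall x : V, a *: x = 0) -> a \in P 0%N
      & forall i, (i < l)%N -> strict_sub (P i) (P i.+1)].

(* dim V is the Krull dimension of A / Ann V. *)
Definition has_dim (n : nat) : Prop :=
  prime_chain n /\ forall l, prime_chain l -> (l <= n)%N.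

Definition covers (N1 N2 : submodClosed V) : Prop :=
  strict_sub N1 N2 /\
  ~ exists N : submodClosed V, strict_sub N1 N /\ strict_sub N N2.

Definition finite_length : Prop :=
  exists n (N : nat -> submodClosed V),
    [/\ N 0%N =i pred1 0, N n =i full V
      & forall i, (i < n)%N -> covers (N i) (N i.+1)].

Definition irreducible_submod (Q : submodClosed V) : Prop :=
  ~ exists N1 N2 : submodClosed V,
      [/\ strict_sub Q N1, strict_sub Q N2 & Q =i [predI N1 & N2]].

Definition irredundant_decomposition
    (N : submodClosed V) (n : nat) (Q : 'I_n -> submodClosed V) : Prop :=
  [/\ forall i, irreducible_submod (Q i),
      forall x, x \in N <-> forall i, x \in Q i
    & forall j, ~ forall x, x \in N <-> forall i, i != j -> x \in Q i].

Definition H0_pred (m : ideal A) : {pred V} :=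
  fun x => `[< exists n, forall a : A, a \in ideal_pow m n -> a *: x = 0 >].

Variable m : ideal A.

Fact ideal_pow_sub n p : {subset ideal_pow m (p + n) <= ideal_pow m n}.
Proof.
elim: p => // p IH a /asboolP[k [b [y [_ yI ->]]]].
by apply: rpred_sum => i _; apply: rpredZ; apply: IH; apply: yI.
Qed.

Fact H0_closed : subsemimod_closed (H0_pred m).
Proof.
split; first split.
- by apply/asboolP; exists 0%N => a _; rewrite scaler0.
- move=> x y /asboolP[n nx] /asboolP[p py]; apply/asboolP.
  exists (p + n)%N => a am; rewrite scalerDr nx ?(ideal_pow_sub am) // py ?addr0 //.
  by move: am; rewrite addnC; apply: ideal_pow_sub.
- move=> c x /asboolP[n nx]; apply/asboolP; exists n => a am.
  by rewrite scalerA mulrC -scalerA nx // scaler0.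
Qed.
HB.instance Definition _ :=
  GRing.isSubmodClosed.Build A V (H0_pred m) H0_closed.
Definition H0 : submodClosed V := H0_pred m.

(* The family s is a basis of V as a vector space over A / m; the second clause
   with the a i in m says in particular that V is killed by m, so that A / m
   acts on V through representatives.                                         *)
Definition residue_basis (n : nat) (s : 'I_n -> V) : Prop :=
  (forall x, exists a : 'I_n -> A, x = \sum_i a i *: s i) /\
  (forall a : 'I_n -> A, \sum_i a i *: s i = 0 <-> forall i, a i \in m).

Definition residue_dim : nat :=
  xget 0%N [set n | exists s : 'I_n -> V, residue_basis s]%classic.

End Modules.

Section Invariants.
Variables (A : comNzRingType) (m : ideal A).

Definition residue_field : lmodType A := quotmod m.

Definition cofinite (I : ideal A) (V : lmodType A) : Prop :=
  finite_length (quotmod (mulmod I (full V))).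

Definition parameter_ideal (q : ideal A) (V : lmodType A) : Prop :=
  [/\ proper q, cofinite q V
    & exists2 d, has_dim V d & exists s : d.-tuple A^o, q =i span s].

Definition index_of_reducibility (I : ideal A) (V : lmodType A) : nat :=
  xget 0%N [set n | exists Q : 'I_n -> submodClosed V,
    irredundant_decomposition (mulmod I (full V)) Q]%classic.

Definition socle_dim (V : lmodType A) : nat :=
  residue_dim (hom residue_field V) m.

Fixpoint regular_seq (s : seq A) (V : lmodType A) : Prop :=
  if s is a :: s' then
    (forall x : V, a *: x = 0 -> x = 0) /\
    regular_seq s' (quotmod (mulmod (span [:: a : A^o]) (full V)))
  else exists x : V, x <> 0.

Definition regular_length (V : lmodType A) (t : nat) : Prop :=
  exists s : seq A,
    [/\ size s = t, forall a, a \in s -> a \in m & regular_seq s V].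

Definition depth (V : lmodType A) : nat :=
  xget 0%N [set t | regular_length V t /\
                    forall u, regular_length V u -> (u <= t)%N]%classic.

Definition module_type (V : lmodType A) : nat :=
  residue_dim (Ext residue_field V (depth V)) m.

End Invariants.

(* Main.v *)
(** Put W = H^0_m(M), N = M/W and q = (a).  A parameter is regular on N, so that
    N has depth one, Ext^1(k, N) is the socle of N/aN, and W embeds in M/aM as soon
    as aM meets W trivially.  Hence dim soc(M/aM) is at most the sum of dim soc(M)
    and dim soc(N/aN), with equality if every socle element of N/aN lifts to one
    of M/aM.  Suppose that it is represented by an x in m^n M, where a is in m^n and
    m^n M meets W trivially: then m x, being in m^n M and in aM + W, is in aM.
    To represent the socle
    of N/aN by elements of m^n M, take b regular on N: from m y in aN with a in
    m^l one gets b y in m^l N, and it remains to cancel b.  For general M, b is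
    any fixed parameter: m^t M is in bM, so that m^(t(n+1)) M is in b^(n+1) M.  For
    M = A, b generates a minimal reduction of m: m^(j+1) = b m^j for all j >= c.
    That minimal reductions are principal is proved with pencils of generators
    b1 - lambda b2, using only that dim m^N / m^(N+1) is bounded for infinitely
    many N. *)
From HB Require Import structures.
From mathcomp Require Import all_boot all_order all_algebra.
From mathcomp Require Import boolp classical_sets functions cardinality.
From mathcomp.multinomials Require Import freeg.
Require Import Defs.

Import GRing.Theory.
Local Open Scope ring_scope.

Set Implicit Arguments.
Unset Strict Implicit.

(** The index of reducibility enters as a dimension: each component of an irredundant decomposition
    of [qM] accounts for one basis vector of the socle of [M/qM], so the formula becomes an equality
    of dimensions over [k]. These are handled inside [M]: a vector space is a subquotient [S/U] with
    [m S <= U], and coefficients are taken in [A] up to [m]. No length function is defined. All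
    counting (uniqueness of dimension, finiteness of socles, termination of decompositions, growth
    of the powers of [m]) goes through a finite filtration with simple or zero layers and the set of
    positions at which a submodule contributes to it.

    The constant for [A] is explained by [n = max{c,d}]: [n >= d] gives that [m^n] meets [W]
    trivially, [n >= c] gives [m^(n+1) = b m^n], and the extra [1] in the bound pays for the factor
    [b] that is cancelled. Dimension one makes parameter ideals principal and makes [M] differ from
    [W]. The infinite residue field supplies as many values of lambda, distinct modulo [m], as the
    pencil argument asks for. *)

Section Submodules.
Variables (A : comNzRingType) (V : lmodType A).
Implicit Types (N U D : submodClosed V) (P : V -> Prop).

(** Many assertions about the elements of a span or of a product are proved by turning the property
    into a submodule and checking generators with [span_sub] or [mulmod_sub]. *)
Definition prop_submod_closed P : Prop :=
  [/\ P 0, forall x y, P x -> P y -> P (x + y) & forall c x, P x -> P (c *: x)].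

Definition prop_submod_pred P (_ : prop_submod_closed P) : {pred V} :=
  fun x => `[< P x >].
Fact prop_submod_subproof P (PP : prop_submod_closed P) :
  subsemimod_closed (prop_submod_pred PP).
Proof.
case: (PP) => P0 PD PZ; split; first split.
- exact/asboolP.
- by move=> x y /asboolP Px /asboolP Py; apply/asboolP/PD.
- by move=> c x /asboolP Px; apply/asboolP/PZ.
Qed.
HB.instance Definition _ P (PP : prop_submod_closed P) :=
  GRing.isSubmodClosed.Build A V (prop_submod_pred PP) (prop_submod_subproof PP).
Definition prop_submod P (PP : prop_submod_closed P) : submodClosed V :=
  prop_submod_pred PP.

Lemma prop_submodE P (PP : prop_submod_closed P) x :
  (x \in prop_submod PP) <-> P x.
Proof. by split=> [/asboolP|Px]; last exact/asboolP. Qed.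

Lemma submodN N x : x \in N -> - x \in N.
Proof. by move=> xN; rewrite -scaleN1r rpredZ. Qed.

Lemma submodB N x y : x \in N -> y \in N -> x - y \in N.
Proof. by move=> xN yN; rewrite rpredD // submodN. Qed.

Lemma submodBr N x y : x - y \in N -> y \in N -> x \in N.
Proof. by move=> xyN yN; rewrite -(subrK y x) rpredD. Qed.

Lemma submodBl N x y : x - y \in N -> x \in N -> y \in N.
Proof. by move=> xyN xN; rewrite -[y](subKr x) submodB. Qed.

Lemma in_full x : x \in (full V : submodClosed V).
Proof. by []. Qed.

Fact zero_submod_subproof : prop_submod_closed (fun x : V => x = 0).
Proof. by split=> [//|x y -> ->|c x ->]; rewrite ?addr0 ?scaler0. Qed.
Definition zero_submod := prop_submod zero_submod_subproof.

Lemma zero_submodE x : (x \in zero_submod) <-> x = 0.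
Proof. exact: prop_submodE. Qed.

Fact cap_submod_subproof N1 N2 :
  prop_submod_closed (fun x => x \in N1 /\ x \in N2).
Proof.
split=> [|x y [? ?] [? ?]|c x [? ?]]; first by rewrite !rpred0.
  by split; apply: rpredD.
by split; apply: rpredZ.
Qed.
Definition cap_submod N1 N2 := prop_submod (cap_submod_subproof N1 N2).

Fact add_elt_subproof N y : prop_submod_closed (fun x => exists c, x - c *: y \in N).
Proof.
split=> [|x x' [c xN] [c' xN']|d x [c xN]].
- by exists 0; rewrite scale0r subr0 rpred0.
- by exists (c + c'); rewrite scalerDl opprD addrACA rpredD.
- by exists (d * c); rewrite -scalerA -scalerBr rpredZ.
Qed.
Definition add_elt N y := prop_submod (add_elt_subproof N y).

Lemma add_eltE N y x : (x \in add_elt N y) <-> exists c, x - c *: y \in N.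
Proof. exact: prop_submodE. Qed.

Lemma add_elt_sub N y : {subset N <= add_elt N y}.
Proof. by move=> x xN; apply/add_eltE; exists 0; rewrite scale0r subr0. Qed.

Lemma add_elt_mem N y : y \in add_elt N y.
Proof. by apply/add_eltE; exists 1; rewrite scale1r subrr rpred0. Qed.

Lemma add_elt_strict N y : y \notin N -> strict_sub N (add_elt N y).
Proof.
by move=> yN; split; [exact: add_elt_sub | exists y; first exact: add_elt_mem].
Qed.

Lemma submod_eqP N1 N2 : (forall x, x \in N1 <-> x \in N2) -> N1 =i N2.
Proof. by move=> E x; apply/idP/idP => /E. Qed.

Lemma nstrict_eq N1 N2 : {subset N1 <= N2} -> ~ strict_sub N1 N2 -> N1 =i N2.
Proof.
move=> s12 ns x; apply/idP/idP => [/s12 //|x2].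
by apply: contra_notT ns => x1; split=> //; exists x.
Qed.

Lemma spanP (s : seq V) x :
  (x \in span s) <-> exists a : 'I_(size s) -> A, x = \sum_i a i *: s`_i.
Proof. by split=> [/asboolP|?]; last exact/asboolP. Qed.

Lemma mem_span (s : seq V) y : y \in s -> y \in span s.
Proof.
move=> ys; apply/spanP; have Hi : (index y s < size s)%N by rewrite index_mem.
exists (fun i => (i == Ordinal Hi)%:R).
rewrite (bigD1 (Ordinal Hi)) //= eqxx scale1r nth_index // big1 ?addr0 //.
by move=> i /negbTE->; rewrite scale0r.
Qed.

Lemma span_sub (s : seq V) N : {in s, forall y, y \in N} -> {subset span s <= N}.
Proof.
move=> sN x /spanP[a ->]; apply: rpred_sum => i _; apply: rpredZ.
by apply: sN; apply: mem_nth.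
Qed.

Lemma span_consP (y : V) (s : seq V) x :
  (x \in span (y :: s)) <-> exists c, x - c *: y \in span s.
Proof.
rewrite -add_eltE; split.
  apply: span_sub => z; rewrite inE => /orP[/eqP->|zs]; first exact: add_elt_mem.
  by apply: add_elt_sub; apply: mem_span.
move=> /add_eltE[c xN]; apply: (submodBr (y := c *: y)).
  by apply: (span_sub _ xN) => z zs; apply: mem_span; rewrite inE zs orbT.
by apply: rpredZ; apply: mem_span; rewrite inE eqxx.
Qed.

Lemma span1P (y x : V) : (x \in span [:: y]) <-> exists c, x = c *: y.
Proof.
rewrite span_consP; split=> -[c].
  by move=> /spanP[a]; rewrite big_ord0 => /eqP; rewrite subr_eq0 => /eqP; exists c.
by move=> ->; exists c; rewrite subrr rpred0.
Qed.

Section Mulmod.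
Variable I : ideal A.

Lemma mulmod_mem N a y : a \in I -> y \in N -> a *: y \in mulmod I N.
Proof.
move=> aI yN; apply/asboolP; exists 1%N, (fun=> a), (fun=> y).
by split=> //; rewrite big_ord1.
Qed.

Lemma mulmod_sub N N' :
  (forall a y, a \in I -> y \in N -> a *: y \in N') -> {subset mulmod I N <= N'}.
Proof.
move=> H x /asboolP[n [a [y [aI yN ->]]]]; apply: rpred_sum => i _; exact: H.
Qed.

End Mulmod.

Lemma mulmodS (I I' : ideal A) N N' :
  {subset I <= I'} -> {subset N <= N'} -> {subset mulmod I N <= mulmod I' N'}.
Proof.
by move=> II NN; apply: mulmod_sub => a y aI yN; apply: mulmod_mem; auto.
Qed.

End Submodules.

Lemma mulmod_span1 (A : comNzRingType) (V : lmodType A) (q : ideal A) (a : A)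
    (N : submodClosed V) : q =i span [:: a : A^o] ->
  forall x, (x \in mulmod q N) <-> exists2 z, z \in N & x = a *: z.
Proof.
move=> qa x; split.
  have cl : prop_submod_closed (fun x => exists2 z, z \in N & x = a *: z).
    split=> [|_ _ [z zN ->] [z' zN' ->]|c _ [z zN ->]].
    - by exists 0; rewrite ?rpred0 ?scaler0.
    - by exists (z + z'); rewrite ?scalerDr ?rpredD.
    - by exists (c *: z); rewrite ?rpredZ // !scalerA mulrC.
  move=> xq; apply/(prop_submodE cl); apply: mulmod_sub xq => b y.
  rewrite qa => /span1P[c ->] yN; apply/(prop_submodE cl).
  by exists (c *: y); rewrite ?rpredZ // scalerA mulrC.
by move=> [z zN ->]; apply: mulmod_mem => //; rewrite qa mem_span ?inE.
Qed.

(** * Powers of an ideal *)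

Section IdealPowers.
Variables (A : comNzRingType).
Implicit Types (I m : ideal A).

Lemma idealMl I (c x : A) : x \in I -> c * x \in I.
Proof. exact: (@rpredZ A A^o I c x). Qed.

Lemma ideal_powS I n a x :
  a \in I -> x \in ideal_pow I n -> a * x \in ideal_pow I n.+1.
Proof. by move=> aI xI; apply: (mulmod_mem (V := A^o)). Qed.

Lemma ideal_pow_le I n p : (n <= p)%N -> {subset ideal_pow I p <= ideal_pow I n}.
Proof. by move=> /subnK <-; apply: ideal_pow_sub. Qed.

Lemma ideal_pow_exp I n a : a \in I -> a ^+ n \in ideal_pow I n.
Proof. by move=> aI; elim: n => // n IH; rewrite exprS; apply: ideal_powS. Qed.

Lemma ideal_powM I n p x y :
  x \in ideal_pow I n -> y \in ideal_pow I p -> x * y \in ideal_pow I (n + p).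
Proof.
move=> xn yp; elim: n x xn => [|n IH] x xn; first exact: idealMl.
have cl : prop_submod_closed (fun x : A^o => (x : A) * y \in ideal_pow I (n.+1 + p)).
  split=> [|u v Hu Hv|c u Hu]; first by rewrite mul0r; apply: rpred0.
    by rewrite mulrDl; apply: rpredD.
  by rewrite -[_ *: _]/((c : A) * u) -mulrA; apply: idealMl.
apply/(prop_submodE cl); apply: mulmod_sub xn => a z aI zn.
by apply/(prop_submodE cl); rewrite -[(_ : A^o) *: _]/((a : A) * z) -mulrA; apply: ideal_powS => //; apply: IH.
Qed.

(** The induction moves one factor [a] into the target, which becomes the preimage of [N] under
    multiplication by [a]; this is why [N] varies. *)
Lemma mulmod_powD (V : lmodType A) I n p (x : V) (N : submodClosed V) :
  (forall c, c \in ideal_pow I n -> forall d, d \in ideal_pow I p -> c *: (d *: x) \in N) ->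
  forall c, c \in ideal_pow I (n + p) -> c *: x \in N.
Proof.
elim: n N => [|n IH] N H c; first by move=> /(H 1 isT); rewrite scale1r.
have cl : prop_submod_closed (fun c : A^o => (c : A) *: x \in N).
  split=> [|u v Hu Hv|e u Hu]; first by rewrite scale0r rpred0.
    by rewrite scalerDl rpredD.
  by rewrite -[e *: u]/((e : A) * u) -scalerA rpredZ.
move=> cI; apply/(prop_submodE cl); apply: mulmod_sub cI => a z aI zI.
apply/(prop_submodE cl) => /=.
have cl' : prop_submod_closed (fun y : V => a *: y \in N).
  split=> [|u v Hu Hv|e u Hu]; first by rewrite scaler0 rpred0.
    by rewrite scalerDr rpredD.
  by rewrite scalerA mulrC -scalerA rpredZ.
rewrite -[(a *: z)%R]/((a : A) * z) -scalerA; apply/(prop_submodE cl'); apply: IH zI => e eI d dI.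
by apply/(prop_submodE cl'); rewrite scalerA; apply: H => //; apply: ideal_powS.
Qed.

End IdealPowers.

(** * Local rings and Nakayama's lemma *)

Section Local.
Variables (A : comNzRingType) (m : ideal A).
Hypothesis A_local : local_ring m.

Lemma local_proper : (1 : A) \notin m. Proof. by case: A_local => -[]. Qed.

(** [local_ring] only says that [m] is the unique maximal ideal; Zorn's lemma turns this into the
    statement that [m] contains every proper ideal. *)
Lemma proper_sub_maximal (J : ideal A) : proper J ->
  exists I : ideal A, maximal_ideal I /\ {subset J <= I}.
Proof.
move=> Jp; pose T := {I : ideal A | proper I /\ {subset J <= I}}.
pose R (I I' : T) := `[< {subset sval I <= sval I'} >].
have [||F Ftot|t tmax] := @ZL_preorder T (exist _ J (conj Jp (fun x xJ => xJ))) R.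
- by move=> I; apply/asboolP.
- by move=> r s t /asboolP rs /asboolP st; apply/asboolP => x /rs/st.
- case: (pselect (exists I, F I)) => [[I0 FI0]|F0]; last first.
    by exists (exist _ J (conj Jp (fun x xJ => xJ))) => s Fs; case: F0; exists s.
  have cl : prop_submod_closed (fun x : A^o => exists2 I, F I & x \in sval I).
    split=> [|x y [I FI xI] [I' FI' yI']|c x [I FI xI]].
    - by exists I0; rewrite ?rpred0.
    - have [/asboolP II|/asboolP II] := Ftot _ _ FI FI'.
        by exists I'; rewrite ?rpredD //; apply: II.
      by exists I; rewrite ?rpredD //; apply: II.
    - by exists I; rewrite ?rpredZ.
  have pU : proper (prop_submod cl) /\ {subset J <= prop_submod cl}.
    split; first by apply/negP => /(prop_submodE cl)[I FI]; apply/negP; case: (svalP I).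
    move=> x xJ; apply/(prop_submodE cl) => /=; exists I0 => //.
    by case: (I0) => I [/= _]; apply.
  exists (exist _ (prop_submod cl) pU) => s Fs; apply/asboolP => x xs /=.
  by apply/(prop_submodE cl) => /=; exists s.
- case: t tmax => I [Ip JI] Imax; exists I; split=> //; split=> // I' I'p II'.
  have pI' : proper I' /\ {subset J <= I'} by split=> // x /JI/II'.
  have /(_ _)/asboolP := Imax (exist _ I' pI').
  move=> H; have /H H' : R (exist _ I (conj Ip JI)) (exist _ I' pI') by apply/asboolP.
  by move=> x; apply/idP/idP => [/H'|/II'].
Qed.

Lemma local_sub (J : ideal A) : proper J -> {subset J <= m}.
Proof.
move=> /proper_sub_maximal[I [Imax JI]] x /JI.
by rewrite (A_local.2 I Imax).
Qed.

Lemma local_unit x : x \notin m -> exists y, y * x = 1.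
Proof.
move=> xm; apply: contrapT => H; move/negP: xm; apply.
apply: (@local_sub (span [:: x : A^o])); last by apply: mem_span; rewrite inE.
by apply/negP => /span1P[y y1]; apply: H; exists y.
Qed.

Lemma local_unit1B x : x \in m -> exists y, y * (1 - x) = 1.
Proof.
move=> xm; apply: local_unit; apply/negP => H; move/negP: local_proper; apply.
by have := rpredD H xm; rewrite subrK.
Qed.

Lemma scale_unit (V : lmodType A) (N : submodClosed V) c x :
  c \notin m -> c *: x \in N -> x \in N.
Proof.
by move=> /local_unit[d dc] H; rewrite -[x]scale1r -dc -scalerA rpredZ.
Qed.

(** Generators modulo [L] are discarded one at a time. If [z :: s'] generates modulo [L] and [K] is
    [span s' + L], the hypothesis on [z] gives [z = c z] modulo [K] with [c] in [m]; as [1 - c] is a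
    unit, [z] is in [K]. *)
Lemma nakayama (V : lmodType A) (s : seq V) (L : submodClosed V) :
  (forall x, x \in span s -> exists2 y, y \in mulmod m (span s) & x - y \in L) ->
  {subset span s <= L}.
Proof.
move=> H; suff E (s' : seq V) : {subset s' <= s} ->
    (forall x, x \in span s -> exists2 y, y \in span s' & x - y \in L) ->
    {subset span s <= L}.
  by apply: (E s) => // x xs; exists x => //; rewrite subrr rpred0.
elim: s' => [_ H'|z s' IH ss H'].
  move=> x /H'[y /spanP[a]]; rewrite big_ord0 => ->.
  by rewrite subr0.
apply: IH => [x xs|]; first by apply: ss; rewrite inE xs orbT.
have cl : prop_submod_closed (fun x : V => exists2 y, y \in span s' & x - y \in L).
  split=> [|u v [y yS uL] [y' yS' vL]|c u [y yS uL]].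
  - by exists 0; rewrite ?subr0 rpred0.
  - by exists (y + y'); [apply: rpredD | rewrite opprD addrACA; apply: rpredD].
  - by exists (c *: y); [apply: rpredZ | rewrite -scalerBr; apply: rpredZ].
set K := prop_submod cl.
have LK : {subset L <= K}.
  by move=> x xL; apply/(prop_submodE cl) => /=; exists 0; rewrite ?rpred0 ?subr0.
have sK : {subset span s' <= K}.
  by move=> x xs; apply/(prop_submodE cl) => /=; exists x; rewrite ?subrr ?rpred0.
suff zK : z \in K.
  move=> x /H'[y /span_consP[c ys] xyL]; apply/(prop_submodE cl).
  by apply: (submodBr (LK _ xyL)); apply: (submodBr (sK _ ys)); apply: rpredZ.
have zs : z \in span s by apply: mem_span; apply: ss; rewrite inE eqxx.
have cl' : prop_submod_closed (fun x : V => exists2 c, c \in m & x - c *: z \in K).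
  split=> [|u v [c cm uL] [d dm vL]|d u [c cm uL]].
  - by exists 0; rewrite ?scale0r ?subr0 rpred0.
  - by exists (c + d); [apply: rpredD | rewrite scalerDl opprD addrACA; apply: rpredD].
  - by exists (d * c); [apply: idealMl | rewrite -scalerA -scalerBr; apply: rpredZ].
have [y ym zyL] := H _ zs.
have : y \in prop_submod cl'.
  apply: mulmod_sub ym => c x cm /H'[x' /span_consP[d xs'] xL].
  apply/(prop_submodE cl') => /=; exists (c * d); first by rewrite mulrC; apply: idealMl.
  rewrite -scalerA -scalerBr rpredZ //; apply: (submodBr (y := x' - d *: z)).
    by rewrite opprB addrA subrK; apply: LK.
  exact: sK.
move=> /(prop_submodE cl')[c cm ycK].
have [u u1] := local_unit1B cm.
rewrite -[z]scale1r -u1 -scalerA; apply: rpredZ; rewrite scalerBl scale1r.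
have -> : z - c *: z = (z - y) + (y - c *: z) by rewrite addrA subrK.
by apply: rpredD => //; apply: LK.
Qed.

End Local.

Lemma subrACA (V : zmodType) (x y z t : V) : x - y - (z - t) = x - z - (y - t).
Proof. by rewrite !opprB [t - z]addrC [t - y]addrC addrACA. Qed.

(** * Dimension over the residue field *)

Section Independence.
Variables (A : comNzRingType) (m : ideal A).
Hypothesis A_local : local_ring m.

Section Basis.
Variable V : lmodType A.
Implicit Types (N U D S : submodClosed V) (C : nat -> submodClosed V).

(* For [m S <= U <= S], this is linear independence of the [z i] in the vector
   space [S / U] over the residue field. *)
Definition indep U k (z : 'I_k -> V) : Prop :=
  forall u : 'I_k -> A, \sum_i u i *: z i \in U -> forall i, u i \in m.

Definition subquotient_basis S U k (z : 'I_k -> V) : Prop :=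
  [/\ forall i, z i \in S,
      forall x, x \in S -> exists u : 'I_k -> A, x - \sum_i u i *: z i \in U
    & indep U z].

Fact colon_subproof U : prop_submod_closed (fun x : V => forall c, c \in m -> c *: x \in U).
Proof.
split=> [c _|x y Hx Hy c cm|d x Hx c cm]; first by rewrite scaler0 rpred0.
  by rewrite scalerDr; apply: rpredD; [apply: Hx | apply: Hy].
by rewrite scalerA mulrC -scalerA; apply: rpredZ; apply: Hx.
Qed.
Definition colon U := prop_submod (colon_subproof U).

Lemma colonE U x : (x \in colon U) <-> forall c, c \in m -> c *: x \in U.
Proof. exact: prop_submodE. Qed.

Lemma indepS U U' k (z : 'I_k -> V) : {subset U' <= U} -> indep U z -> indep U' z.
Proof. by move=> UU Uz u /UU/Uz. Qed.

Definition layer D D' : Prop :=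
  forall x y, x \in D -> y \in D -> y \notin D' -> exists v, x - v *: y \in D'.

(* The positions at which [D] contributes to the filtration; their number is the
   length of the image of [D] modulo [C p]. *)
Definition gaps C p D : {set 'I_p} :=
  [set i : 'I_p | `[< exists2 x, x \in D & x \in C i /\ x \notin C i.+1 >]].

Lemma gapsS C p D D' : {subset D <= D'} -> gaps C p D \subset gaps C p D'.
Proof.
move=> DD; apply/fintype.subsetP => i; rewrite !finset.in_set => /asboolP[x /DD xD H].
by apply/asboolP; exists x.
Qed.

Lemma card_gaps_le C p D : (#|gaps C p D| <= p)%N.
Proof. by rewrite -[leqRHS](card_ord p) max_card. Qed.

(** If both had the same gaps, subtracting elements of [D] would push any element of [D'] down the
    filtration as far as [C p], hence into [D]. *)
Lemma gaps_strict C p D D' : {subset D' <= C 0%N} -> {subset C p <= D} ->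
  (forall i, (i < p)%N -> layer (C i) (C i.+1)) ->
  strict_sub D D' -> (#|gaps C p D| < #|gaps C p D'|)%N.
Proof.
move=> D'C CD lay [DD [x0 x0D' /negP x0D]].
have sub := gapsS C p DD.
rewrite ltn_neqAle subset_leq_card // andbT; apply: contra_not_neq x0D => E.
have {}sub : gaps C p D' \subset gaps C p D.
  have /eqP-> : gaps C p D == gaps C p D'; last exact: subxx.
  by rewrite finset.eqEcard sub E leqnn.
suff H j : (j <= p)%N -> forall x, x \in D' -> x \in C (p - j)%N -> x \in D.
  by apply: (H p (leqnn _)) => //; rewrite subnn; apply: D'C.
elim: j => [_ x _|j IH jp x xD' xC]; first by rewrite subn0; apply: CD.
have jS : (p - j = (p - j.+1).+1)%N by rewrite subnSK.
have ltp : (p - j.+1 < p)%N by rewrite -jS leq_subr.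
have [xC'|xC'] := boolP (x \in C (p - j)%N); first by apply: IH => //; apply: ltnW.
have /(fintype.subsetP sub) : Ordinal ltp \in gaps C p D'.
  by rewrite finset.in_set; apply/asboolP; exists x => //; split=> //=; rewrite -jS.
rewrite finset.in_set => /asboolP[y yD [/= yC yC']].
have [v vC] := lay _ ltp x y xC yC yC'.
apply: (submodBr (y := v *: y)); last exact: rpredZ.
apply: IH; [exact: ltnW | by apply: submodB => //; apply: rpredZ; apply: DD|].
by rewrite jS.
Qed.

(** Adjoining [z ord0] to [D] creates a new gap, and the remaining vectors stay independent modulo
    the enlarged submodule. *)
Lemma indep_gaps C p D D' k (z : 'I_k -> V) :
  {subset D' <= C 0%N} -> {subset C p <= D} ->
  (forall i, (i < p)%N -> layer (C i) (C i.+1)) ->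
  {subset D <= D'} -> (forall i, z i \in D') -> indep D z ->
  (#|gaps C p D| + k <= #|gaps C p D'|)%N.
Proof.
move=> D'C + lay; elim: k D z => [|k IH] D z CD DD zD' Dz.
  by rewrite addn0 subset_leq_card // gapsS.
have z0D : z ord0 \notin D.
  apply/negP => z0D; move/negP: (local_proper A_local); apply.
  have := Dz (fun i => (i == ord0)%:R) _ ord0; rewrite eqxx; apply.
  rewrite big_ord_recl eqxx scale1r big1 ?addr0 // => i _.
  by rewrite eq_sym (negbTE (neq_lift _ _)) scale0r.
have st := add_elt_strict z0D.
have H := gaps_strict (D := D) (D' := add_elt D (z ord0)) _ CD lay st.
have sD' : {subset add_elt D (z ord0) <= D'}.
  move=> x /add_eltE[c /DD xD]; apply: (submodBr xD); exact: rpredZ.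
rewrite addnS -addSn; apply: (leq_trans (leq_add (H _) (leqnn k))).
  by move=> x /sD'/D'C.
apply: (IH _ (fun i => z (fintype.lift ord0 i))) => // [x /CD|u uD i]; first exact: add_elt_sub.
move/add_eltE: uD => [c cD].
(* A relation modulo [D + A z0] is a relation modulo [D] with coefficient [- c] on [z0]. *)
pose w (j : 'I_k.+1) := if unlift ord0 j is Some i then u i else - c.
have := Dz w _ (fintype.lift ord0 i); rewrite /w liftK; apply.
rewrite big_ord_recl unlift_none addrC scaleNr.
by under eq_bigr do rewrite liftK.
Qed.

(** In place of an exchange argument, gaps are counted along the chain of the
    [U + span(e j, j >= i)], which leads from [S] to [U] in [k] layers. *)
Lemma basis_indep_le S U k k' (e : 'I_k -> V) (z : 'I_k' -> V) :
  {subset U <= S} -> (forall c x, c \in m -> x \in S -> c *: x \in U) ->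
  subquotient_basis S U e ->
  (forall i, z i \in S) -> indep U z -> (k' <= k)%N.
Proof.
move=> US mS [eS eG eI] zS zI.
have cl i : prop_submod_closed (fun x : V =>
    exists u : 'I_k -> A, x - \sum_(j < k | (i <= j)%N) u j *: e j \in U).
  split=> [|x y [u xU] [v yU]|c x [u xU]].
  - by exists (fun=> 0); rewrite big1 ?subr0 ?rpred0 // => j _; rewrite scale0r.
  - exists (fun j => u j + v j); under eq_bigr do rewrite scalerDl.
    by rewrite big_split opprD addrACA; apply: rpredD.
  - exists (fun j => c * u j); under eq_bigr do rewrite -scalerA.
    by rewrite -scaler_sumr -scalerBr; apply: rpredZ.
pose C i := prop_submod (cl i).
suff : (#|gaps C k U| + k' <= #|gaps C k S|)%N.
  by move=> H; apply: leq_trans (card_gaps_le C k S); apply: leq_trans H; apply: leq_addl.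
apply: (indep_gaps (z := z)) => // [x /eG[u xU]|x|i ik x y].
- by apply/(prop_submodE (cl 0%N)); exists u.
- move=> /(prop_submodE (cl k))[u]; rewrite big_pred0 ?subr0 // => j.
  by rewrite leqNgt ltn_ord.
- move=> /(prop_submodE (cl i))[u xU] /(prop_submodE (cl i))[v yU] /negP yC.
  have split_i (w : 'I_k -> A) : \sum_(j < k | (i <= j)%N) w j *: e j =
      w (Ordinal ik) *: e (Ordinal ik) + \sum_(j < k | (i.+1 <= j)%N) w j *: e j.
    rewrite (bigD1 (Ordinal ik)) //=; congr (_ + _); apply: eq_bigl => j.
    by rewrite ltn_neqAle andbC eq_sym.
  have vm : v (Ordinal ik) \notin m.
    apply/negP => vm; apply: yC; apply/(prop_submodE (cl i.+1)); exists v.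
    move: yU; rewrite split_i opprD addrCA => yU.
    rewrite -[X in X \in _](addNKr (v (Ordinal ik) *: e (Ordinal ik))).
    by apply: rpredD => //; apply: mS.
  have [d dv] := local_unit A_local vm.
  exists (u (Ordinal ik) * d); apply/(prop_submodE (cl i.+1)).
  exists (fun j => u j - u (Ordinal ik) * d * v j).
  set t := _ * d; have tv : t * v (Ordinal ik) = u (Ordinal ik) by rewrite -mulrA dv mulr1.
  have := submodB xU (rpredZ t yU).
  rewrite !split_i; under [X in _ -> _ - X \in _]eq_bigr do rewrite scalerBl -scalerA.
  rewrite sumrB -scaler_sumr scalerBr scalerDr scalerA tv.
  set a := u _ *: _; set b := \sum_(_ < _ | _) _; set c := _ *: (\sum_(_ < _ | _) _).
  suff -> : x - (a + b) - (t *: y - (a + c)) = x - t *: y - (b - c) by [].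
  by rewrite subrACA [a + b]addrC addrKA.
Qed.

Lemma basis_uniq S U k k' (e : 'I_k -> V) (z : 'I_k' -> V) :
  {subset U <= S} -> (forall c x, c \in m -> x \in S -> c *: x \in U) ->
  subquotient_basis S U e -> subquotient_basis S U z -> k' = k.
Proof.
move=> US mS He Hz; apply/eqP; rewrite eqn_leq; apply/andP; split.
  by case: Hz => zS _ zI; apply: basis_indep_le He zS zI.
by case: He => eS _ eI; apply: basis_indep_le Hz eS eI.
Qed.

Lemma basis_exists S U p :
  (forall c x, c \in m -> x \in S -> c *: x \in U) ->
  (forall k (z : 'I_k -> V), (forall i, z i \in S) -> indep U z -> (k <= p)%N) ->
  exists k (e : 'I_k -> V), subquotient_basis S U e.
Proof.
move=> mS bnd.
pose P k := `[< exists e : 'I_k -> V, (forall i, e i \in S) /\ indep U e >].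
have P0 : exists k, P k by exists 0%N; apply/asboolP; exists (fun=> 0); split=> [[]//|u _ []//].
have Pp k : P k -> (k <= p)%N by move=> /asboolP[e [eS eI]]; apply: bnd eI.
case: (ex_maxnP P0 Pp) => k /asboolP[e [eS eI]] kmax.
exists k, e; split=> // x xS; apply: contrapT => H.
suff : P k.+1 by move/kmax; rewrite ltnn.
apply/asboolP; exists (fun i => if unlift ord0 i is Some j then e j else x).
split=> [i|u]; first by case: unliftP => [j _|_]; [apply: eS|].
rewrite big_ord_recl unlift_none; under eq_bigr do rewrite liftK.
move=> uU.
(* Were this coefficient a unit, [x] would be a combination of the [e i] modulo [U]. *)
have u0 : u ord0 \in m.
  apply/negPn/negP => /(local_unit A_local)[d du]; apply: H.
  exists (fun i => - d * u (fintype.lift ord0 i)); under eq_bigr do rewrite -scalerA.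
  by rewrite -scaler_sumr scaleNr opprK -[x]scale1r -du -scalerA -scalerDr; apply: rpredZ.
have {}uU : \sum_i u (fintype.lift ord0 i) *: e i \in U.
  by rewrite -[X in X \in _](addKr (u ord0 *: x)); apply: rpredD => //; apply/submodN/mS.
by move=> i; case: (unliftP ord0 i) => [j ->|->] //; apply: (eI _ uU).
Qed.

(** A nonzero submodule of [V / U] generated by an element killed by a power of [m] contains a
    nonzero socle element. *)
Lemma colon_exists U x t : x \notin U -> (forall c, c \in ideal_pow m t -> c *: x \in U) ->
  exists2 c, c *: x \notin U & c *: x \in colon U.
Proof.
elim: t x => [|t IH] x xU H.
  by move/negP: xU; case; rewrite -[x]scale1r; apply: H.
have [xc|/negP xc] := boolP (x \in colon U); first by exists 1; rewrite scale1r.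
have [c cm cx] : exists2 c, c \in m & c *: x \notin U.
  apply: contrapT => H'; apply: xc; apply/colonE => c cm; apply/negPn/negP => cx.
  by apply: H'; exists c.
have [|d d1 d2] := IH _ cx; last by exists (d * c); rewrite -scalerA.
by move=> d dm; rewrite scalerA mulrC; apply: H; apply: ideal_powS.
Qed.

End Basis.

Lemma residue_basisE (V : lmodType A) k (e : 'I_k -> V) :
  residue_basis m e <->
  (forall c (x : V), c \in m -> c *: x = 0) /\ subquotient_basis (full V) (zero_submod V) e.
Proof.
split=> [[gen ind]|[kil [_ gen ind]]].
  split=> [c x cm|].
    have [a ->] := gen x; rewrite scaler_sumr; under eq_bigr do rewrite scalerA.
    by apply/ind => i; rewrite mulrC; apply: idealMl.
  split=> // [x _|u]; last by move=> /zero_submodE/ind.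
  by have [u ->] := gen x; exists u; rewrite subrr rpred0.
split=> [x|a]; first by have [//|u /zero_submodE/subr0_eq ->] := gen x; exists u.
split=> [/zero_submodE/ind //|am]; rewrite big1 // => i _; exact: kil.
Qed.

Lemma residue_dimE (V : lmodType A) k (e : 'I_k -> V) :
  residue_basis m e -> residue_dim V m = k.
Proof.
move=> He; apply: xget_unique; first by exists e.
move=> k' [e' He']; move/residue_basisE: He => [kil He]; move/residue_basisE: He' => [_ He'].
apply: basis_uniq He He' => // c x cm _; apply/zero_submodE; exact: kil.
Qed.

End Independence.

Section Quotient.
Variables (A : comNzRingType) (V : lmodType A) (U : submodClosed V).

Lemma quotmod_pi0 : quotmod_pi U 0 = 0.
Proof.
by apply: (@addrI _ (quotmod_pi U 0)); rewrite -quotmod_piD !addr0.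
Qed.

Lemma quotmod_pi0P x : (quotmod_pi U x = 0) <-> x \in U.
Proof.
by rewrite -quotmod_pi0; split=> [/quotmod_piP|xU]; last apply/quotmod_piP; rewrite subr0.
Qed.

Fact preim_subproof (N : submodClosed (quotmod U)) :
  prop_submod_closed (fun x : V => quotmod_pi U x \in N).
Proof.
split=> [|x y Hx Hy|c x Hx]; first by rewrite quotmod_pi0 rpred0.
  by rewrite quotmod_piD; apply: rpredD.
by rewrite quotmod_piZ; apply: rpredZ.
Qed.
Definition preim N := prop_submod (preim_subproof N).

Lemma preimE N x : (x \in preim N) <-> quotmod_pi U x \in N.
Proof. exact: prop_submodE. Qed.

End Quotient.

(** * Finite length, and the torsion submodule [H0] *)

Section FiniteLength.
Variables (A : comNzRingType) (m : ideal A).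
Hypothesis A_local : local_ring m.
Variable V : lmodType A.
Implicit Types (N U D : submodClosed V) (C : nat -> submodClosed V).

Fact dilate_subproof (b : A) N :
  prop_submod_closed (fun x : V => exists2 z, z \in N & x = b *: z).
Proof.
split=> [|_ _ [z zN ->] [z' zN' ->]|c _ [z zN ->]].
- by exists 0; rewrite ?rpred0 ?scaler0.
- by exists (z + z'); rewrite ?scalerDr ?rpredD.
- by exists (c *: z); rewrite ?rpredZ // !scalerA mulrC.
Qed.
Definition dilate b N := prop_submod (dilate_subproof b N).

Lemma dilateE b N x : (x \in dilate b N) <-> exists2 z, z \in N & x = b *: z.
Proof. exact: prop_submodE. Qed.

Lemma mem_dilate b N x : x \in N -> b *: x \in dilate b N.
Proof. by move=> xN; apply/dilateE; exists x. Qed.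

Lemma mulmod_span1E (q : ideal A) (a : A) N :
  q =i span [:: a : A^o] -> mulmod q N =i dilate a N.
Proof.
by move=> qa; apply: submod_eqP => x; rewrite dilateE; exact: mulmod_span1.
Qed.

(** A witness that [V / U] has length at most [p]. It descends from [V], so that [m^i V] lies in
    [C i]. *)
Definition filtration p C U : Prop :=
  [/\ C 0%N =i full V, C p =i U & forall i, (i < p)%N -> layer (C i) (C i.+1)].

Lemma finite_length_filtration U :
  finite_length (quotmod U) -> exists p C, filtration p C U.
Proof.
move=> [p [N [N0 Np Ncov]]]; exists p, (fun i => preim (N (p - i)%N)); split.
- by apply: submod_eqP => x; rewrite preimE subn0 Np; split.
- apply: submod_eqP => x; rewrite preimE subnn N0 -quotmod_pi0P.
  by split=> [/eqP|->]; last exact/eqP.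
- move=> i ip x y /preimE xN /preimE yN /negP yN'.
  have ltp : (p - i.+1 < p)%N by rewrite ltn_subrL; case: (p) ip.
  have [_ cov] := Ncov _ ltp; rewrite subnSK // in cov.
  have {}yN' : quotmod_pi U y \notin N (p - i.+1)%N by apply/negP => /preimE/yN'.
  have [[sub1 _] _] := Ncov _ ltp; rewrite subnSK // in sub1.
  have sub2 : {subset add_elt (N (p - i.+1)%N) (quotmod_pi U y) <= N (p - i)%N}.
    by move=> z /add_eltE[c /sub1 zN]; apply: (submodBr zN); apply: rpredZ.
  have E : add_elt (N (p - i.+1)%N) (quotmod_pi U y) =i N (p - i)%N.
    apply: nstrict_eq => // st; apply: cov; eexists; split; last exact: st.
    exact: add_elt_strict.
  move: xN; rewrite -E => /add_eltE[v vN]; exists v; apply/preimE.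
  suff -> : quotmod_pi U (x - v *: y) = quotmod_pi U x - v *: quotmod_pi U y by [].
  by rewrite -scaleNr quotmod_piD quotmod_piZ scaleNr.
Qed.

(** Otherwise [x = v c x] modulo [D'] for some [v], and [1 - v c] is a unit. *)
Lemma layer_scale D D' c x : layer D D' -> c \in m -> x \in D -> c *: x \in D'.
Proof.
move=> lay cm xD; apply/negPn/negP => cx.
have [v] := lay x (c *: x) xD (rpredZ c xD) cx.
have [u u1] := local_unit1B A_local (idealMl v cm).
rewrite scalerA -{1}[x]scale1r -scalerBl => H; case/negP: cx.
by rewrite -[x]scale1r -u1 -[(u * _) *: x]scalerA; do 2! apply: rpredZ.
Qed.

Lemma filtration_pow p C U c x :
  filtration p C U -> c \in ideal_pow m p -> c *: x \in U.
Proof.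
case=> C0 Cp lay; rewrite -Cp.
suff H j : (j <= p)%N -> forall c, c \in ideal_pow m j -> c *: x \in C j by apply: H.
elim: j => [_ d _|j IH jp d dm]; first by rewrite C0.
have cl : prop_submod_closed (fun d : A^o => (d : A) *: x \in C j.+1).
  split=> [|u v Hu Hv|e u Hu]; first by rewrite scale0r rpred0.
    by rewrite scalerDl rpredD.
  by rewrite -[e *: u]/((e : A) * u) -scalerA rpredZ.
apply/(prop_submodE cl); apply: mulmod_sub dm => a z aI zI; apply/(prop_submodE cl).
rewrite -[(a *: z)%R]/((a : A) * z) -scalerA; apply: (layer_scale (lay _ jp)) => //.
by apply: IH => //; apply: ltnW.
Qed.

Lemma pow_dilate t (b : A) : (forall c x, c \in ideal_pow m t -> c *: x \in dilate b (full V)) ->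
  forall n c x, c \in ideal_pow m (t * n) -> c *: x \in dilate (b ^+ n) (full V).
Proof.
move=> Ht; elim=> [|n IH] c x.
  by move=> _; apply/dilateE; exists (c *: x); rewrite // scale1r.
rewrite mulnS; apply: mulmod_powD => {}c cm d /(IH d x)/dilateE[z _ ->].
have /dilateE[z' _ E] := Ht _ z cm.
by rewrite scalerA mulrC -scalerA E scalerA -exprSr; apply: mem_dilate.
Qed.

Section Noetherian.
Hypothesis A_noetherian : noetherian A.

Lemma submod_fg (s : seq V) N : {subset N <= span s} -> exists s', N =i span s'.
Proof.
elim: s N => [|x s IH] N Ns.
  exists [::] => y; apply/idP/idP; first exact: Ns.
  by move=> /spanP[a ->]; rewrite big_ord0 rpred0.
(* The coefficients of [x] in elements of [N], modulo [span s], form a finitely generated ideal.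
   Lifts of its generators to [N], together with generators of the intersection of [N] and [span s],
   generate [N]. *)
have clI : prop_submod_closed (fun c : A^o => exists2 z, z \in N & z - (c : A) *: x \in span s).
  split=> [|u v [z zN zs] [z' zN' zs']|c u [z zN zs]].
  - by exists 0; rewrite ?rpred0 // scale0r subr0 rpred0.
  - by exists (z + z'); [apply: rpredD | rewrite scalerDl opprD addrACA; apply: rpredD].
  - exists (c *: z); first exact: rpredZ.
    by rewrite -[(c *: u)%R]/((c : A) * u) -scalerA -scalerBr; apply: rpredZ.
have [ts tsE] := A_noetherian (prop_submod clI).
have [|s2 s2E] := IH (cap_submod N (span s)).
  by move=> y /prop_submodE[].
have /choice[f fP] (t : A^o) : exists z, t \in ts -> z \in N /\ z - (t : A) *: x \in span s.
  have [tts|_] := boolP (t \in ts); last by exists 0.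
  have : t \in prop_submod clI by rewrite tsE mem_span.
  by move=> /(prop_submodE clI)[z zN zs]; exists z.
exists (map f ts ++ s2); set K := span _.
have s2N y : y \in s2 -> y \in N /\ y \in span s.
  by move=> ys2; have := mem_span ys2; rewrite -s2E => /prop_submodE.
have KN : {subset K <= N}.
  apply: span_sub => y; rewrite mem_cat => /orP[/mapP[t tts ->]|/s2N[]//].
  by case: (fP t tts).
move=> y; apply/idP/idP; last exact: KN.
move=> yN; have /span_consP[c cs] := Ns _ yN.
have cl : prop_submod_closed (fun c : A^o => exists2 z, z \in K & z - (c : A) *: x \in span s).
  split=> [|u v [z zN zs] [z' zN' zs']|d u [z zN zs]].
  - by exists 0; rewrite ?rpred0 // scale0r subr0 rpred0.
  - by exists (z + z'); [apply: rpredD | rewrite scalerDl opprD addrACA; apply: rpredD].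
  - exists (d *: z); first exact: rpredZ.
    by rewrite -[(d *: u)%R]/((d : A) * u) -scalerA -scalerBr; apply: rpredZ.
have /(prop_submodE cl)[z zK zs] : (c : A^o) \in prop_submod cl.
  have : (c : A^o) \in prop_submod clI by apply/(prop_submodE clI); exists y.
  rewrite tsE; apply: span_sub => t tts; apply/(prop_submodE cl); exists (f t).
    by apply: mem_span; rewrite mem_cat map_f.
  by case: (fP t tts).
apply: (submodBr (y := z)) => //.
have : y - z \in span s2.
  rewrite -s2E; apply/prop_submodE; split; first by apply: submodB => //; apply: KN.
  have -> : y - z = (y - c *: x) - (z - c *: x) by rewrite subrACA subrr subr0.
  exact: submodB.
by apply: span_sub => w ws2; apply: mem_span; rewrite mem_cat ws2 orbT.
Qed.

Lemma H0P x : (x \in H0 V m) <-> exists n, forall a, a \in ideal_pow m n -> a *: x = 0.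
Proof. by split=> [/asboolP|?]; last exact/asboolP. Qed.

(* [b] acts injectively on the quotient by its own torsion [T], which is some
   kernel of [b ^+ n]; hence [T] meets [b ^+ n V], and so [m ^ (t n) V], trivially. *)
Lemma H0_uniform t (b : A) : finitely_generated V -> b \in m ->
  (forall c x, c \in ideal_pow m t -> c *: x \in dilate b (full V)) ->
  (exists u, forall x, x \in H0 V m -> forall c, c \in ideal_pow m u -> c *: x = 0)
  /\ (forall x, b *: x \in H0 V m -> x \in H0 V m).
Proof.
move=> [s Vs] bm Ht.
have cl : prop_submod_closed (fun x : V => exists n, b ^+ n *: x = 0).
  split=> [|x y [n nx] [p py]|c x [n nx]]; first by exists 0%N; rewrite scaler0.
    exists (n + p)%N; rewrite scalerDr {1}addnC !exprD -!scalerA nx py.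
    by rewrite !scaler0 addr0.
  by exists n; rewrite scalerA mulrC -scalerA nx scaler0.
have [|sT sTE] := submod_fg (s := s) (N := prop_submod cl).
  by move=> x _; rewrite -Vs.
have [n nT] : exists n, forall x, x \in prop_submod cl -> b ^+ n *: x = 0.
  suff [n nT] : exists n, {in sT, forall x, b ^+ n *: x = 0}.
    have cl' : prop_submod_closed (fun x : V => b ^+ n *: x = 0).
      split=> [|x y nx ny|c x nx]; first by rewrite scaler0.
        by rewrite scalerDr nx ny addr0.
      by rewrite scalerA mulrC -scalerA nx scaler0.
    exists n => x; rewrite sTE => xs; apply/(prop_submodE cl').
    by apply: span_sub xs => y ys; apply/(prop_submodE cl')/nT.
  have : {in sT, forall x, x \in prop_submod cl} by move=> x /mem_span; rewrite sTE.
  elim: (sT) => [_|x s' IH H]; first by exists 0%N.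
  have [|n nT] := IH; first by move=> y ys; apply: H; rewrite inE ys orbT.
  have /(prop_submodE cl)[p px] := H x (mem_head _ _).
  exists (n + p)%N => y; rewrite inE => /orP[/eqP->|/nT ny].
    by rewrite exprD -scalerA px scaler0.
  by rewrite addnC exprD -scalerA ny scaler0.
(* Here [c x = b^n z], and [z] is again torsion for [b], hence killed by [b^n]. *)
have killT (x : V) j : b ^+ j *: x = 0 -> forall c, c \in ideal_pow m (t * n) -> c *: x = 0.
  move=> jx c cm; have /dilateE[z _ E] := pow_dilate Ht x cm.
  rewrite E; apply: nT; apply/(prop_submodE cl); exists (j + n)%N.
  by rewrite exprD -scalerA -E scalerA mulrC -scalerA jx scaler0.
split; first exists (t * n)%N.
  by move=> x /H0P[j xj]; apply: killT (xj _ (ideal_pow_exp _ bm)).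
move=> x /H0P[j xj]; apply/H0P; exists (t * n)%N; apply: (killT _ j.+1).
by rewrite exprSr -scalerA; apply/xj/ideal_pow_exp.
Qed.

Lemma H0_exp_regular (b : A) : (forall x, b *: x \in H0 V m -> x \in H0 V m) ->
  forall j x, b ^+ j *: x \in H0 V m -> x \in H0 V m.
Proof.
move=> Hb; elim=> [|j IH] x; first by rewrite scale1r.
by rewrite exprS -scalerA => /Hb/IH.
Qed.

Lemma dilate_cap_H0 (b : A) u : b \in m ->
  (forall x, x \in H0 V m -> forall c, c \in ideal_pow m u -> c *: x = 0) ->
  (forall x, b *: x \in H0 V m -> x \in H0 V m) ->
  forall x, x \in dilate (b ^+ u) (full V) -> x \in H0 V m -> x = 0.
Proof.
move=> bm Hu Hb x /dilateE[z _ ->] /(H0_exp_regular Hb) zW.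
exact: Hu zW _ (ideal_pow_exp _ bm).
Qed.

End Noetherian.
End FiniteLength.

(** * The index of reducibility as a socle dimension *)

Section Reducibility.
Variables (A : comNzRingType) (m : ideal A).
Hypothesis A_local : local_ring m.
Variable V : lmodType A.
Implicit Types (N U D : submodClosed V).

Definition decomposition U n (Q : 'I_n -> submodClosed V) : Prop :=
  (forall i, irreducible_submod (Q i)) /\ forall x, x \in U <-> forall i, x \in Q i.

(** Induction on [p] minus the number of gaps of [D], which drops when [D] is replaced by a strictly
    larger submodule. *)
Lemma decomposition_exists p C U D : filtration p C U -> {subset U <= D} ->
  exists n (Q : 'I_n -> submodClosed V), decomposition D Q.
Proof.
case=> C0 Cp lay; have [k] := ubnP (p - #|gaps C p D|); elim: k D => // k IH D Dk UD.
case: (pselect (irreducible_submod D)) => [irr|/contrapT [N1 [N2 [s1 s2 DE]]]].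
  by exists 1%N, (fun=> D); split=> // x; split=> // /(_ ord0).
have step N : strict_sub D N -> exists n (Q : 'I_n -> submodClosed V), decomposition N Q.
  move=> st; apply: IH; last by move=> x /UD; apply: st.1.
  have lt : (#|gaps C p D| < #|gaps C p N|)%N.
    by apply: gaps_strict => // x; rewrite ?C0 // Cp; apply: UD.
  rewrite ltnS in Dk; apply: leq_trans Dk; rewrite ltn_sub2l //.
  exact: leq_trans lt (card_gaps_le _ _ _).
have [n1 [Q1 [irr1 E1]]] := step _ s1; have [n2 [Q2 [irr2 E2]]] := step _ s2.
pose Q (i : 'I_(n1 + n2)) := match fintype.split i with inl j => Q1 j | inr j => Q2 j end.
exists (n1 + n2)%N, Q; split=> [i|x]; first by rewrite /Q; case: fintype.split.
have -> : (x \in D) <-> (x \in N1 /\ x \in N2).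
  by rewrite DE; split=> [/andP[]//|[x1 x2]]; apply/andP.
rewrite E1 E2; split=> [[H1 H2] i|H]; first by rewrite /Q; case: fintype.split.
split=> i; first by have := H (unsplit (inl i)); rewrite /Q unsplitK.
by have := H (unsplit (inr i)); rewrite /Q unsplitK.
Qed.

Lemma irredundant_decomposition_exists p C U : filtration p C U ->
  exists n (Q : 'I_n -> submodClosed V), irredundant_decomposition U Q.
Proof.
move=> filtr.
pose P n := `[< exists Q : 'I_n -> submodClosed V, decomposition U Q >].
have Pex : exists n, P n.
  have [//|n [Q HQ]] := decomposition_exists filtr (D := U).
  by exists n; apply/asboolP; exists Q.
case: (ex_minnP Pex) => n /asboolP[Q [irr E]] nmin; exists n, Q; split=> // j H.
case: n j Q irr E nmin H => [[]//|n] j Q irr E nmin H.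
suff : P n by move/nmin; rewrite ltnn.
apply/asboolP; exists (fun i => Q (fintype.lift j i)); split=> // x; rewrite H.
split=> [Hx i|Hx i]; first by apply: Hx; rewrite eq_sym neq_lift.
by case: (unliftP j i) => [k ->|->]; rewrite ?eqxx.
Qed.

(** By irredundance there is, for each [j], a socle element of [V / U] that lies in every component
    but [Q j]. These form a dual system: working modulo [Q i] isolates the [i]-th coefficient. *)
Lemma irredundant_decomposition_basis p C U n (Q : 'I_n -> submodClosed V) :
  filtration p C U -> irredundant_decomposition U Q ->
  exists e : 'I_n -> V, subquotient_basis m (colon m U) U e.
Proof.
move=> filtr [irr E redun].
have UQ i x : x \in U -> x \in Q i by move/E.
have /choice[e eP] j : exists x, [/\ x \in colon m U, x \notin Q j
    & forall i, i != j -> x \in Q i].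
  have [x xQ xU] : exists2 x, (forall i, i != j -> x \in Q i) & x \notin U.
    apply: contrapT => H; apply: (redun j) => x; split=> [/E//|xQ].
    by apply/negPn/negP => xU; apply: H; exists x.
  have [|c cU cc] := colon_exists (m := m) (t := p) xU.
    by move=> c cm; exact: (filtration_pow A_local _ filtr cm).
  exists (c *: x); split=> // [|i ij]; last by apply/rpredZ/xQ.
  apply/negP => cQ; case/negP: cU; apply/E => i.
  by have [->//|/xQ xQi] := eqVneq i j; apply: rpredZ.
exists e; split=> [i|x xc|u uU i]; first by case: (eP i).
(* Irreducibility makes the socle of [V / Q i] one-dimensional: [Q i + A x] and [Q i + A e_i] share
   an element outside [Q i], and its coefficient on [x] is a unit because [m x] lies in [Q i]. *)
- have /choice[c cP] i : exists c, x - c *: e i \in Q i.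
    have [xQ|xQ] := boolP (x \in Q i); first by exists 0; rewrite scale0r subr0.
    have [ec eQ _] := eP i.
    have [z [z1 z2 zQ]] : exists z, [/\ z \in add_elt (Q i) x, z \in add_elt (Q i) (e i)
        & z \notin Q i].
      apply: contrapT => H; apply: (irr i); exists (add_elt (Q i) x), (add_elt (Q i) (e i)).
      split; [exact: add_elt_strict | exact: add_elt_strict|].
      move=> z; apply/idP/idP => [zQ|/andP[z1 z2]].
        by apply/andP; split; apply: add_elt_sub.
      by apply/negPn/negP => zQ; apply: H; exists z.
    have /add_eltE[a azQ] := z1; have /add_eltE[b bzQ] := z2.
    have am : a \notin m.
      apply/negP => am; case/negP: zQ; apply: (submodBr azQ); apply: UQ.
      exact: (iffLR (colonE _ _ _) xc).
    have [d da] := local_unit A_local am.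
    exists (d * b); rewrite -[x in x - _]scale1r -da -!scalerA -scalerBr.
    apply: rpredZ; have := submodB bzQ azQ.
    by rewrite subrACA subrr sub0r opprB.
  exists c; apply/E => i; rewrite (bigD1 i) //= opprD addrA; apply: submodB => //.
  by apply: rpred_sum => j ji; apply: rpredZ; have [_ _] := eP j; apply; rewrite eq_sym.
- apply/negPn/negP => ui; have [_ /negP eQ eQ'] := eP i; apply: eQ.
  apply: (scale_unit A_local ui); have := UQ i _ uU; rewrite (bigD1 i) //= => H.
  rewrite -[_ *: _](addrK (\sum_(j < n | j != i) u j *: e j)); apply: submodB => //.
  by apply: rpred_sum => j ji; apply: rpredZ; have [_ _] := eP j; apply; rewrite eq_sym.
Qed.

Lemma index_of_reducibilityE p C (q : ideal A) k (e : 'I_k -> V) :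
  filtration p C (mulmod q (full V)) ->
  subquotient_basis m (colon m (mulmod q (full V))) (mulmod q (full V)) e ->
  index_of_reducibility q V = k.
Proof.
move=> filtr He; set U := mulmod q (full V) in filtr He *.
have uniq n : (exists Q : 'I_n -> submodClosed V, irredundant_decomposition U Q) -> n = k.
  move=> [Q /(irredundant_decomposition_basis filtr)[e' He']].
  apply: (basis_uniq A_local _ _ He He') => [x xU|c x cm /colonE]; last exact.
  by apply/colonE => c _; apply: rpredZ.
have [n [Q HQ]] := irredundant_decomposition_exists filtr.
have nk : n = k by apply: uniq; exists Q.
by apply: xget_unique => //; rewrite -nk; exists Q.
Qed.

End Reducibility.

(** * Linear maps and free modules *)

Section HomLemmas.
Variables (A : comNzRingType) (U V : lmodType A).

Definition to_hom (f : U -> V) (lf : linear f) : hom U V :=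
  exist (fun g => g \in hom_pred (U:=U) (V:=V)) f (asboolT lf).

Lemma hom_app_linear (f : hom U V) : linear (hom_app f).
Proof. by apply/asboolP; exact: (submod_val_in f). Qed.

Lemma hom_appP (f g : hom U V) : hom_app f =1 hom_app g -> f = g.
Proof. by move=> fg; apply: submod_val_inj; apply: funext. Qed.

Lemma hom_app_sum k (f : 'I_k -> hom U V) x :
  hom_app (\sum_i f i) x = \sum_i hom_app (f i) x.
Proof.
apply: (big_morph (fun f : hom U V => hom_app f x)) => [f' g|]; first exact: hom_appD.
exact: hom_app0.
Qed.

End HomLemmas.

Section LinearFunctions.
Variables (A : comNzRingType) (U V : lmodType A) (f : U -> V).
Hypothesis lf : linear f.

Lemma lin0 : f 0 = 0.
Proof. by have := lf (-1) 0 0; rewrite scaler0 addr0 scaleN1r addNr. Qed.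

Lemma linZ c x : f (c *: x) = c *: f x.
Proof. by rewrite -[c *: x]addr0 lf lin0 addr0. Qed.

Lemma linD x y : f (x + y) = f x + f y.
Proof. by rewrite -[x]scale1r lf !scale1r. Qed.

Lemma linB x y : f (x - y) = f x - f y.
Proof. by rewrite -!scaleN1r linD linZ. Qed.

End LinearFunctions.

Section FreeModule.
Variables (A : comNzRingType) (K : choiceType) (V : lmodType A).

Lemma freeg_scaleU (c d : A) (x : K) :
  c *: (<< d *g x >> : {freeg K / A}) = << c * d *g x >>.
Proof.
apply/eqP/freeg_eqP => y.
by rewrite [LHS]coeff_fgscale !coeffU mulrA.
Qed.

Lemma linear_freegP (f g : {freeg K / A} -> V) : linear f -> linear g ->
  (forall x, f << x >> = g << x >>) -> f =1 g.
Proof.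
move=> lf lg fg w; rewrite -(freeg_sumE w).
elim: (dom w) => [|x s IH]; first by rewrite big_nil (lin0 lf) (lin0 lg).
rewrite big_cons (linD lf) (linD lg) IH; congr (_ + _).
by rewrite -[coeff x w]mulr1 -freeg_scaleU (linZ lf) (linZ lg) fg.
Qed.

Lemma fglift_linear (psi : K -> V) : linear (fglift psi : {freeg K / A} -> V).
Proof.
have additive_psi := lift_is_additive psi.
have D (u v : {freeg K / A}) : fglift psi (u + v) = fglift psi u + fglift psi v.
  have H0 : fglift psi (0 : {freeg K / A}) = 0 by have := additive_psi 0 0; rewrite !subr0 subrr.
  have HN w : fglift psi (- w : {freeg K / A}) = - fglift psi w.
    by rewrite -[LHS]/(_) -{1}(sub0r w) additive_psi H0 sub0r.
  by rewrite -{1}(opprK v) additive_psi HN opprK.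
have H0 : fglift psi (0 : {freeg K / A}) = 0 by have := additive_psi 0 0; rewrite !subr0 subrr.
move=> c u v; rewrite D; congr (_ + _).
rewrite -(freeg_sumE u) scaler_sumr !(big_morph _ D H0) scaler_sumr.
by apply: eq_bigr => x _; rewrite freeg_scaleU !liftU scalerA.
Qed.

End FreeModule.

(** * [Hom(k, V)] and the socle of [V] *)

Section Socle.
Variables (A : comNzRingType) (m : ideal A).
Hypothesis A_local : local_ring m.
Local Notation k := (residue_field m).
Local Notation pi := (quotmod_pi m : A -> k).

Lemma residue_lift : {tau : k -> A | forall x, pi (tau x) = x}.
Proof.
apply: cid; have /choice[f fP] (x : k) : exists c : A, pi c = x.
  by have [y ->] := quotmod_pi_surj x; exists y.
by exists f.
Qed.
Let tau := sval residue_lift.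
Let tauK : forall x, pi (tau x) = x := svalP residue_lift.

Lemma pi_eq0 (c : A) : (pi c = 0) <-> c \in m.
Proof. exact: quotmod_pi0P. Qed.

Lemma pi_scale c d : c *: pi d = pi (c * d).
Proof. by rewrite -quotmod_piZ. Qed.

Lemma tau_sub x c : pi c = x -> tau x - c \in m.
Proof. by move=> cx; apply/(quotmod_piP m); rewrite tauK cx. Qed.

Lemma tau1_unit : tau (pi 1) \notin m.
Proof.
apply/negP => H; have := tau_sub (erefl (pi 1)) => /submodBl/(_ H).
exact/negP/local_proper.
Qed.

(** A map [f] corresponds to [f 1]. Conversely [tau] is only a set-theoretic section of [A -> k],
    but [x |-> tau x *: e i] is linear because [m] kills [e i]. *)
Lemma socle_dimE (V : lmodType A) n (e : 'I_n -> V) :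
  subquotient_basis m (colon m (zero_submod V)) (zero_submod V) e -> socle_dim m V = n.
Proof.
move=> [eS eG eI].
have eK i c : c \in m -> c *: e i = 0 by move=> cm; apply/zero_submodE/(colonE m _ _).1.
have lphi i : linear (fun x : k => tau x *: e i).
  move=> c x y; rewrite scalerA -scalerDl; apply/subr0_eq; rewrite -scalerBl.
  by apply/eK/tau_sub; rewrite quotmod_piD -pi_scale !tauK.
pose phi i := to_hom (lphi i).
have phiE (u : 'I_n -> A) x : hom_app (\sum_i u i *: phi i) x = tau x *: \sum_i u i *: e i.
  rewrite hom_app_sum scaler_sumr; apply: eq_bigr => i _.
  by rewrite hom_appZ !scalerA mulrC.
apply: (residue_dimE A_local (e := phi)).
split=> [f|u].
- pose y := hom_app f (pi 1); have lf := hom_app_linear f.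
  have [u /zero_submodE/subr0_eq yE] : exists u : 'I_n -> A, y - \sum_i u i *: e i \in zero_submod V.
    apply: eG; apply/colonE => c cm; apply/zero_submodE; rewrite -(linZ lf) pi_scale mulr1.
    by rewrite (pi_eq0 c).2 // (lin0 lf).
  exists u; apply: hom_appP => x; rewrite phiE -yE -(linZ lf) pi_scale mulr1 tauK //.
split=> [E|um].
  (* Evaluation at [1] introduces the factor [tau (pi 1)], which may differ from [1] but is a
     unit. *)
  apply: eI; apply: (scale_unit A_local tau1_unit); apply/zero_submodE.
  by rewrite -phiE E hom_app0.
by apply: hom_appP => x; rewrite phiE hom_app0 big1 ?scaler0 // => i _; apply: eK.
Qed.

End Socle.

(** * The depth of [N] is one *)

Section Depth.
Variables (A : comNzRingType) (m : ideal A).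
Hypothesis A_local : local_ring m.
Variables (N : lmodType A) (a : A) (t : nat).
Hypotheses (N_fg : finitely_generated N) (N_neq0 : exists x : N, x <> 0).
Hypotheses (am : a \in m) (a_reg : forall x : N, a *: x = 0 -> x = 0).
Hypothesis a_cofinite : forall c (x : N), c \in ideal_pow m t -> c *: x \in dilate a (full N).

Lemma dilate_proper : exists x : N, x \notin dilate a (full N).
Proof.
case: N_neq0 N_fg => x0 x0N [s Ns]; apply: contrapT => H; apply: x0N.
apply/zero_submodE; apply: (nakayama A_local (s := s)); last by rewrite -Ns.
move=> x _; have /dilateE[z _ ->] : x \in dilate a (full N).
  by apply/negPn/negP => xa; apply: H; exists x.
by exists (a *: z); [apply: mulmod_mem => //; rewrite -Ns | rewrite subrr rpred0].
Qed.

Lemma mulmod_span1_full (b : A) :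
  mulmod (span [:: b : A^o]) (full N) =i dilate b (full N).
Proof. exact: mulmod_span1E. Qed.

(* If [y] is a socle element modulo [a N] and [b1 y = a z], [b2 y = a z'], then
   [b2 z = b1 z'], so that [z] is a multiple of [b1] and [y] one of [a]. *)
Lemma regular_length_le1 u : regular_length m N u -> (u <= 1)%N.
Proof.
move=> [[|b1 [|b2 s]] [<- sm]] //= [b1_reg [b2_reg _]].
have b1m : b1 \in m by apply: sm; rewrite mem_head.
have b2m : b2 \in m by apply: sm; rewrite !in_cons eqxx orbT.
have [x xa] := dilate_proper.
have [c] := colon_exists xa (fun c => @a_cofinite c x).
move: {c x xa}(c *: x) => y /negP yaN /colonE ya; exfalso.
have /dilateE[z _ zE] := ya _ b1m; have /dilateE[z' _ z'E] := ya _ b2m.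
have E : b2 *: z = b1 *: z'.
  apply/subr0_eq; apply: a_reg; rewrite scalerBr !scalerA ![a * _]mulrC -!scalerA.
  by rewrite -zE -z'E !scalerA mulrC subrr.
set J := mulmod (span [:: b1 : A^o]) (full N) in b2_reg.
have : z \in J.
  apply/quotmod_pi0P; apply: b2_reg; rewrite -quotmod_piZ; apply/quotmod_pi0P.
  by rewrite mulmod_span1_full E; apply: mem_dilate.
rewrite mulmod_span1_full => /dilateE[w _ wE]; apply: yaN; apply/dilateE; exists w => //.
apply/subr0_eq; apply: b1_reg.
by rewrite scalerBr zE wE !scalerA mulrC subrr.
Qed.

Lemma depth_eq1 : depth m N = 1%N.
Proof.
have L1 : regular_length m N 1.
  exists [:: a]; split=> // [b|]; first by rewrite inE => /eqP->.
  split; first exact: a_reg.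
  have [x /negP xa] := dilate_proper; exists (quotmod_pi _ x) => /quotmod_pi0P.
  by rewrite mulmod_span1_full.
apply: xget_unique => [|u [Lu umax]]; first by split=> // u; exact: regular_length_le1.
by apply/eqP; rewrite eqn_leq regular_length_le1 //= umax.
Qed.

End Depth.

(** * [Ext^1(k, N)] and the socle of [N / aN] *)

Section Ext1.
Variables (A : comNzRingType) (m : ideal A).
Hypothesis A_local : local_ring m.
Variables (N : lmodType A) (a : A).
Hypotheses (am : a \in m) (a_reg : forall x : N, a *: x = 0 -> x = 0).
Local Notation k := (residue_field m).
Local Notation pi := (quotmod_pi m : A -> k).
Local Notation F0 := (resol k 0).
Local Notation F1 := (resol k 1).
Local Notation F2 := (resol k 2).
Local Notation d1 := (@resol_diff A k 0).
Local Notation d2 := (@resol_diff A k 1).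
Local Notation aN := (dilate a (full N)).
Local Notation cocycles := (cocycle N d2).
Local Notation coboundaries :=
  (coboundary_pred (N := N) d1 (d2 := d2) : submodClosed cocycles).

Lemma eval_free_linear (X : lmodType A) : linear (@eval_free A X).
Proof. exact: fglift_linear. Qed.

Lemma eval_freeU (X : lmodType A) (x : X) : eval_free << x >> = x.
Proof. by rewrite [LHS]liftU scale1r. Qed.

Lemma resol_diff_linear (X : lmodType A) i : linear (@resol_diff A X i).
Proof.
move=> c u v; rewrite /resol_diff -submod_valZ -submod_valD.
by congr submod_val; exact: eval_free_linear.
Qed.

Lemma eval_resol_diff (X : lmodType A) i (u : resol X i.+1) :
  eval_free (resol_diff u) = 0 :> syzygy X i.
Proof. by apply/eqP; exact: (submod_val_in (eval_free u : syzygy X i.+1)). Qed.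

Lemma resol_exact (X : lmodType A) i (w : resol X i) :
  eval_free w = 0 :> syzygy X i -> exists u : resol X i.+1, resol_diff u = w.
Proof.
move=> w0; have wK : w \in ker_eval_pred (X := syzygy X i) by apply/eqP.
exists << (exist _ w wK : syzygy X i.+1) >>.
by rewrite /resol_diff eval_freeU.
Qed.

Lemma resol_diff_kernel (X : lmodType A) i (v : resol X i.+1) :
  resol_diff v = 0 -> exists u : resol X i.+2, resol_diff u = v.
Proof.
move=> v0; apply: resol_exact; apply: submod_val_inj.
by rewrite submod_val0.
Qed.

Let tau : k -> A := sval (residue_lift m).
Let tauK x : pi (tau x) = x. Proof. exact: (svalP (residue_lift m)). Qed.
(** Extending [tau] from the basis makes it linear: [rho] lifts the augmentation of the resolution
    to [A], and so it maps boundaries into [m]. *)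
Let rho : F0 -> A := fglift (tau : k -> A^o).

Let rho_linear : linear (rho : F0 -> A^o). Proof. exact: fglift_linear. Qed.
Let rhoU (x : k) : rho << x >> = tau x. Proof. by rewrite /rho liftU scale1r. Qed.

Let pi_rho w : pi (rho w) = eval_free w.
Proof.
apply: (linear_freegP (f := fun w : F0 => pi (rho w))) => [c u v||x].
- by rewrite (rho_linear c u v) quotmod_piD -pi_scale.
- exact: eval_free_linear.
- by rewrite rhoU tauK eval_freeU.
Qed.

Let rho_d1 v : rho (d1 v) \in m.
Proof. by apply/pi_eq0; rewrite pi_rho eval_resol_diff. Qed.

Definition cocycle_app (f : cocycles) : F1 -> N := hom_app (cocycle_val f).

Lemma cocycle_appD f g v : cocycle_app (f + g) v = cocycle_app f v + cocycle_app g v.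
Proof. by rewrite /cocycle_app cocycle_valD hom_appD. Qed.

Lemma cocycle_appZ c f v : cocycle_app (c *: f) v = c *: cocycle_app f v.
Proof. by rewrite /cocycle_app cocycle_valZ hom_appZ. Qed.

Lemma cocycle_app_linear f : linear (cocycle_app f).
Proof. exact: hom_app_linear. Qed.

Lemma cocycle_app_kernel f v : d1 v = 0 -> cocycle_app f v = 0.
Proof.
move=> /resol_diff_kernel[u <-].
by have /asboolP := submod_val_in (f : submod_type _); apply.
Qed.

Lemma to_cocycle (h : F1 -> N) : linear h -> (forall u, h (d2 u) = 0) ->
  exists f : cocycles, cocycle_app f =1 h.
Proof.
move=> lh h0.
have hc : to_hom lh \in cocycle_pred (N := N) d2 by apply/asboolP.
by exists (exist _ (to_hom lh) hc).
Qed.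

Lemma coboundaryP (f : cocycles) : (f \in coboundaries) <->
  exists2 g : F0 -> N, linear g & forall v, cocycle_app f v = g (d1 v).
Proof.
split=> [/asboolP[g gf]|[g lg gf]]; last by apply/asboolP; exists (to_hom lg).
by exists (hom_app g) => //; exact: hom_app_linear.
Qed.

(* The connecting map [Hom(k, N / aN) -> Ext^1(k, N)]: [f] is the class attached to
   the socle element [y]. *)
Let connects (f : cocycles) (y : N) : Prop :=
  forall v, a *: cocycle_app f v = rho (d1 v) *: y.

Let connects_lin c f g y z :
  connects f y -> connects g z -> connects (c *: f + g) (c *: y + z).
Proof.
move=> fy gz v; rewrite cocycle_appD cocycle_appZ !scalerDr gz.
by rewrite !scalerA ![_ * c]mulrC -!scalerA fy.
Qed.

Let connects_sum n (u : 'I_n -> A) (f : 'I_n -> cocycles) (y : 'I_n -> N) :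
  (forall i, connects (f i) (y i)) ->
  connects (\sum_i u i *: f i) (\sum_i u i *: y i).
Proof.
move=> fy; elim/big_rec2: _ => [v|i z g _ H].
  by rewrite scaler0 -[0 in LHS](scale0r (0 : cocycles)) cocycle_appZ scale0r scaler0.
exact: connects_lin.
Qed.

Let a_inj (x y : N) : a *: x = a *: y -> x = y.
Proof. by move=> E; apply/subr0_eq/a_reg; rewrite scalerBr E subrr. Qed.

(** Each [rho (d1 v) y] is in [aN], and regularity of [a] makes the quotient by [a] unique, hence
    linear in [v]. *)
Let connects_exists y : y \in colon m aN -> exists f, connects f y.
Proof.
move=> /colonE yS.
have /choice[h hE] v : exists z, rho (d1 v) *: y = a *: z.
  by have /dilateE[z _ ->] := yS _ (rho_d1 v); exists z.
have lh : linear h.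
  move=> c u v; apply: a_inj; rewrite -hE resol_diff_linear rho_linear scalerDl hE.
  by rewrite scalerDr -scalerA hE !scalerA mulrC.
have [|f fh] := to_cocycle lh; last by exists f => v; rewrite fh hE.
move=> u; apply: a_reg; rewrite -hE.
have -> : d1 (d2 u) = 0 by rewrite {1}/resol_diff eval_resol_diff submod_val0.
by rewrite (lin0 rho_linear) scale0r.
Qed.

(** If [f] is the coboundary of [g], it is tested on a preimage of [a eps], which is a boundary
    because [a] is in [m]: cancelling [a] leaves [rho eps *: y = a *: g eps], where [rho eps] is a
    unit. *)
Let connects_coboundary f y : connects f y ->
  f \in coboundaries <-> y \in aN.
Proof.
move=> fy; rewrite coboundaryP dilateE; split=> [[g lg gf]|[z _ yE]]; last first.
  exists (fun w => rho w *: z) => [c u v|v].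
    by rewrite rho_linear scalerDl scalerA.
  by apply: a_inj; rewrite fy yE !scalerA mulrC.
pose eps : F0 := << (pi 1 : k) >>.
have E : rho eps *: y = a *: g eps.
  apply/subr0_eq; apply: a_reg.
  have [v vE] : exists v, d1 v = a *: eps.
    apply: resol_exact; rewrite (linZ (@eval_free_linear _)) eval_freeU pi_scale mulr1.
    exact/pi_eq0.
  have := fy v; rewrite gf vE (linZ lg) (linZ rho_linear) -scalerA => H.
  by rewrite scalerBr -H subrr.
have := local_unit A_local (tau1_unit A_local); rewrite -[sval _]/tau -rhoU => -[d dE].
by exists (d *: g eps) => //; rewrite -[y]scale1r -dE -scalerA E !scalerA mulrC.
Qed.

(** Transported to the kernel of the augmentation, [f] becomes [phi]. This kernel contains [a F0],
    and splitting [w] as [(w - rho w eps) + rho w eps] gives [phi (a w) = a g w + rho w y] with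
    [y = phi (a eps)]. On [w = d1 v] this says that [f] minus the coboundary of [g] is attached to
    [y]. *)
Let connects_onto f : exists y f', [/\ y \in colon m aN, connects f' y
  & f - f' \in coboundaries].
Proof.
pose eps : F0 := << (pi 1 : k) >>.
have evl := @eval_free_linear k.
have ev_eps : eval_free eps = pi 1 by exact: eval_freeU.
(* [sigma] is an arbitrary choice of preimages; by exactness [f] vanishes on the kernel of [d1], so
   the choice does not affect [phi] on the kernel of the augmentation. *)
have /choice[sigma sigmaE] (w : F0) : exists v : F1, eval_free w = 0 :> k -> d1 v = w.
  have [w0|n] := pselect (eval_free w = 0 :> k).
    by have [v vE] := resol_exact (X := k) (i := 0%N) w0; exists v.
  by exists 0.
pose phi w := cocycle_app f (sigma w).
have phi_d1 v : phi (d1 v) = cocycle_app f v.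
  apply/subr0_eq; rewrite -(linB (cocycle_app_linear f)); apply: cocycle_app_kernel.
  by rewrite (linB (@resol_diff_linear _ _)) sigmaE ?subrr // eval_resol_diff.
have phi_lin c w w' : eval_free w = 0 :> k -> eval_free w' = 0 :> k ->
    phi (c *: w + w') = c *: phi w + phi w'.
  move=> w0 w0'.
  have -> : c *: w + w' = d1 (c *: sigma w + sigma w').
    by rewrite resol_diff_linear !sigmaE.
  rewrite phi_d1.
  exact: cocycle_app_linear.
have phi0 : phi 0 = 0.
  have := phi_lin (-1) 0 0; rewrite scaler0 addr0 (lin0 evl) => /(_ erefl erefl) ->.
  by rewrite scaleN1r addNr.
have phiZ c w : eval_free w = 0 :> k -> phi (c *: w) = c *: phi w.
  by move=> w0; rewrite -[c *: w]addr0 phi_lin ?(lin0 evl) // phi0 addr0.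
have keps c : c \in m -> eval_free (c *: eps) = 0 :> k.
  by move=> cm; rewrite (linZ evl) ev_eps pi_scale mulr1; apply/pi_eq0.
pose y := phi (a *: eps).
have yS : y \in colon m aN.
  apply/colonE => c cm; rewrite -phiZ ?keps // scalerA mulrC -scalerA phiZ ?keps //.
  exact: mem_dilate.
pose psi (x : k) := phi (<< x >> - tau x *: eps).
have kpsi (x : k) : eval_free (<< x >> - tau x *: eps) = 0 :> k.
  by rewrite (linB evl) (linZ evl) ev_eps eval_freeU pi_scale mulr1 tauK subrr.
pose g : F0 -> N := fglift psi.
have lg : linear g by exact: fglift_linear.
have ka (w : F0) : eval_free (a *: w) = 0 :> k.
  by rewrite (linZ evl) -pi_rho pi_scale; apply/pi_eq0; rewrite mulrC; apply: idealMl.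
have key w : phi (a *: w) = a *: g w + rho w *: y.
  apply: (linear_freegP (f := fun w => phi (a *: w)) (g := fun w => a *: g w + rho w *: y)).
  - by move=> c u v; rewrite scalerDr scalerA mulrC -scalerA phi_lin.
  - move=> c u v; rewrite lg rho_linear scalerDl !scalerDr !scalerA [a * c]mulrC addrACA.
    by [].
  - move=> x; rewrite rhoU /g liftU scale1r /psi -phiZ //.
    rewrite -[RHS]addrC -phi_lin ?keps //; congr phi.
    by rewrite scalerBr addrC scalerA mulrC -scalerA subrK.
have [f' ff'] := connects_exists yS; exists y, f'; split=> //.
apply/coboundaryP; exists g => // v; apply: a_inj.
rewrite -scaleN1r addrC cocycle_appD cocycle_appZ scaleN1r addrC scalerBr ff'.
have := key (d1 v); rewrite phiZ; last exact: (eval_resol_diff (X := k) (i := 0%N) v).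
by rewrite phi_d1 => ->; rewrite addrK.
Qed.

(** The relation [connects] induces an isomorphism: [connects_coboundary] makes it well defined and
    injective, [connects_onto] surjective. *)
Lemma Ext1_dimE n (e : 'I_n -> N) :
  subquotient_basis m (colon m aN) aN e -> residue_dim (Ext k N 1) m = n.
Proof.
move=> [eS eG eI].
have /choice[f fP] i := connects_exists (eS i).
have piS (u : 'I_n -> A) : \sum_i u i *: quotmod_pi coboundaries (f i) =
    quotmod_pi coboundaries (\sum_i u i *: f i) :> Ext k N 1.
  elim/big_rec2: _ => [|i y x _ ->]; first by rewrite quotmod_pi0.
  by rewrite quotmod_piD quotmod_piZ.
apply: (residue_dimE A_local (e := fun i => quotmod_pi _ (f i) : Ext k N 1)).
split=> [X|u].
  have [h ->] := quotmod_pi_surj X.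
  have [y [h' [yS h'y hh']]] := connects_onto h; have [u uE] := eG _ yS.
  exists u; rewrite piS; apply/quotmod_piP.
  apply: (submodBr (y := h' - \sum_i u i *: f i)).
    by rewrite opprB addrA subrK.
  apply/(connects_coboundary (y := y - \sum_i u i *: e i)) => //.
  have := connects_lin (-1) (connects_sum u fP) h'y.
  by rewrite !scaleN1r ![- _ + _]addrC.
rewrite piS quotmod_pi0P (connects_coboundary (connects_sum u fP)).
split=> [/eI//|um]; apply: rpred_sum => i _.
by apply: (iffLR (colonE m aN (e i))).
Qed.

End Ext1.

(** * The formula for a single parameter ideal *)

Section IndexFormula.
Variables (A : comNzRingType) (m : ideal A).
Hypotheses (A_noetherian : noetherian A) (A_local : local_ring m).
Variables (V : lmodType A) (q : ideal A) (a : A) (n : nat).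
Local Notation W := (H0 V m).
Local Notation mnV := (mulmod (ideal_pow m n) (full V)).
Local Notation aV := (dilate a (full V)).
Hypotheses (V_fg : finitely_generated V) (V_neq : exists x : V, x \notin W).
Hypotheses (qa : q =i span [:: a : A^o]) (am : a \in m).
Hypothesis q_cofinite : cofinite q V.
(** The demands on [n]: the module case and the ring case meet them with different values of [n]. *)
Hypothesis W_mnV : forall x, x \in mnV -> x \in W -> x = 0.
Hypothesis socle_mnV : forall y,
  (forall c, c \in m -> exists z, c *: y - a *: z \in W) ->
  exists2 v, v \in mnV & y - v \in W.
Hypothesis amn : a \in ideal_pow m n.

Let qV_E : mulmod q (full V) =i aV. Proof. exact: mulmod_span1E. Qed.

Lemma filtration_indep_le p C (U : submodClosed V) k (z : 'I_k -> V) :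
  filtration p C U -> indep m U z -> (k <= p)%N.
Proof.
case=> C0 Cp lay zI.
have := indep_gaps A_local (C := C) (D' := full V) _ _ lay _ (fun _ => isT) zI.
move=> H; apply: leq_trans (card_gaps_le C p (full V)); apply: leq_trans (H _ _ _).
- exact: leq_addl.
- by move=> x _; rewrite C0.
- by move=> x; rewrite Cp.
- by [].
Qed.

Let aVW x : x \in aV -> x \in W -> x = 0.
Proof. by move=> /dilateE[z _ ->]; apply/W_mnV/mulmod_mem. Qed.

Let N := quotmod W.
Local Notation aN := (dilate a (full N)).
Local Notation pi := (quotmod_pi W : V -> N).
(** This is [aV + W]; it allows the socle of [N / aN] to be treated as a subquotient of [V]. *)
Let U' := preim aN.

Let U'E x : (x \in U') <-> exists z, x - a *: z \in W.
Proof.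
rewrite preimE dilateE; split=> [[Z _]|[z zW]].
  have [z ->] := quotmod_pi_surj Z; rewrite -quotmod_piZ => /quotmod_piP H.
  by exists z.
by exists (pi z) => //; rewrite -quotmod_piZ; apply/quotmod_piP.
Qed.

Let aV_U' : {subset aV <= U'}.
Proof. by move=> x /dilateE[z _ ->]; apply/U'E; exists z; rewrite subrr rpred0. Qed.

Let W_U' : {subset W <= U'}.
Proof. by move=> x xW; apply/U'E; exists 0; rewrite scaler0 subr0. Qed.

Let colon0_W : {subset colon m (zero_submod V) <= W}.
Proof.
move=> x /colonE xm; apply/H0P; exists 1%N => c cm.
by apply/zero_submodE/xm; move: c cm; apply: mulmod_sub => c y cm _;
   rewrite -[(c *: y)%R]/((c : A) * y) mulrC; apply: idealMl.
Qed.

Let socle_lift y : y \in colon m U' -> exists2 x, x \in colon m aV & y - x \in U'.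
Proof.
move=> /colonE ym; have [|v vmn yv] := socle_mnV (y := y).
  by move=> c /ym/U'E.
exists v; last exact: W_U'.
apply/colonE => c cm; have /U'E[z zW] := ym _ cm.
apply/dilateE; exists z => //; apply/subr0_eq; apply: W_mnV.
  by apply: submodB; [apply: rpredZ | apply: mulmod_mem].
have -> : c *: v - a *: z = (c *: y - a *: z) - c *: (y - v).
  by rewrite scalerBr subrACA subrr sub0r opprB addrC.
by apply: submodB => //; apply: rpredZ.
Qed.

Let sumcat k1 k2 (e1 : 'I_k1 -> V) (e2 : 'I_k2 -> V) (u : 'I_(k1 + k2) -> A) :
  let e i := match fintype.split i with inl j => e1 j | inr j => e2 j end in
  \sum_i u i *: e i =
    \sum_i u (lshift k2 i) *: e1 i + \sum_i u (rshift k1 i) *: e2 i.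
Proof.
move=> e; rewrite big_split_ord /=; congr (_ + _); apply: eq_bigr => i _.
  by rewrite /e (unsplitK (inl i)).
by rewrite /e (unsplitK (inr i)).
Qed.

(** Additivity of dimension along socles of [V], [V / aV] and [V / U']. For exactness in the middle,
    a socle element of [V / aV] lying in [U'] is some [w] in [W] modulo [aV]; then [m w] lies in
    both [aV] and [W], so [w] is in the socle of [V]. *)
Let basis_cat k1 k2 (e1 : 'I_k1 -> V) (e2 : 'I_k2 -> V) :
  subquotient_basis m (colon m (zero_submod V)) (zero_submod V) e1 ->
  subquotient_basis m (colon m U') U' e2 -> (forall i, e2 i \in colon m aV) ->
  subquotient_basis m (colon m aV) aV
    (fun i => match fintype.split i with inl j => e1 j | inr j => e2 j end).
Proof.
move=> [e1S e1G e1I] [_ e2G e2I] e2S.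
have e1W i : e1 i \in W by apply: colon0_W.
split=> [i|y yS|u].
- case: (fintype.split i) => j //; apply/colonE => c cm.
  by have /colonE/(_ c cm)/zero_submodE -> := e1S j; rewrite rpred0.
- have [|c2 /U'E[z zW]] := e2G y.
    by move/colonE: yS => yS; apply/colonE => c /yS/aV_U'.
  set w := _ - a *: z in zW.
  have [|c1 /zero_submodE/subr0_eq c1E] := e1G w.
    apply/colonE => c cm; apply/zero_submodE/aVW; last exact: rpredZ.
    rewrite /w !scalerBr; apply: submodB; last by apply/rpredZ/mem_dilate.
    apply: submodB; first by apply: (iffLR (colonE _ _ _) yS).
    by apply: (iffLR (colonE m aV _) _ c cm); apply: rpred_sum => i _; apply: rpredZ.
  pose c i := match fintype.split i with inl j => c1 j | inr j => c2 j end.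
  exists c; rewrite sumcat.
  have -> : \sum_i c (lshift k2 i) *: e1 i = w.
    by rewrite c1E; apply: eq_bigr => i _; rewrite /c (unsplitK (inl i)).
  have -> : \sum_i c (rshift k1 i) *: e2 i = \sum_i c2 i *: e2 i.
    by apply: eq_bigr => i _; rewrite /c (unsplitK (inr i)).
  rewrite /w addrAC subrK opprB addrC subrK.
  by apply/dilateE; exists z.
- rewrite sumcat => uS.
  have u2 i : u (rshift k1 i) \in m.
    apply: (e2I (fun i => u (rshift k1 i))).
    rewrite -[X in X \in _](addKr (\sum_i u (lshift k2 i) *: e1 i)); apply: rpredD.
      by apply/submodN/W_U'/rpred_sum => j _; apply: rpredZ.
    exact: aV_U'.
  have u1 i : u (lshift k2 i) \in m.
    apply: (e1I (fun i => u (lshift k2 i))); apply/zero_submodE/aVW.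
      rewrite -[X in X \in _](addrK (\sum_i u (rshift k1 i) *: e2 i)).
      apply: submodB => //; apply: rpred_sum => j _.
      by apply: (iffLR (colonE m aV _)).
    by apply: rpred_sum => j _; apply: rpredZ.
  by move=> i; rewrite -(splitK i); case: (fintype.split i) => j /=.
Qed.

Lemma index_formula :
  index_of_reducibility q V = (socle_dim m V + module_type m (quotmod W))%N.
Proof.
have [p [C filtr]] := finite_length_filtration q_cofinite.
have a_cof c (x : V) : c \in ideal_pow m p -> c *: x \in aV.
  by move=> cm; rewrite -qV_E; exact: (filtration_pow A_local x filtr cm).
have [_ regW] := H0_uniform A_noetherian V_fg am a_cof.
have a_reg (X : N) : a *: X = 0 -> X = 0.
  have [x ->] := quotmod_pi_surj X.
  by rewrite -quotmod_piZ => /quotmod_pi0P/regW xW; apply/quotmod_pi0P.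
have N_fg : finitely_generated N.
  case: V_fg => s Vs; exists (map pi s) => X; apply/esym; rewrite in_full.
  have [x ->] := quotmod_pi_surj X; apply/preimE.
  have : x \in span s by rewrite -Vs.
  by apply: span_sub => y ys; apply/preimE/mem_span/map_f.
have N_neq0 : exists X : N, X <> 0.
  by case: V_neq => x /negP xW; exists (pi x) => /quotmod_pi0P.
have N_cof (c : A) (X : N) : c \in ideal_pow m p -> c *: X \in aN.
  have [x ->] := quotmod_pi_surj X; rewrite -quotmod_piZ => /(a_cof _ x)/dilateE[z _ ->].
  by rewrite quotmod_piZ; apply: mem_dilate.
have [k1 [e1 B1]] : exists k (e : 'I_k -> V),
    subquotient_basis m (colon m (zero_submod V)) (zero_submod V) e.
  (* The socle of [V] lies in [W], which meets [aV] trivially; so independent socle elements remain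
     independent modulo [aV], and there are at most [p] of them. *)
  apply: (basis_exists A_local (p := p)) => [c x cm /colonE|k z zS zI]; first exact.
  apply: (filtration_indep_le filtr (z := z)) => u uU; apply: zI; apply/zero_submodE/aVW.
    by rewrite -qV_E.
  by apply: rpred_sum => i _; apply/rpredZ/colon0_W.
have [k2 [y [yS yG yI]]] : exists k (e : 'I_k -> V), subquotient_basis m (colon m U') U' e.
  apply: (basis_exists A_local (p := p)) => [c x cm /colonE|k z zS zI]; first exact.
  apply: (filtration_indep_le filtr (z := z)); apply: indepS zI => x.
  by rewrite qV_E; apply: aV_U'.
have piS (u : 'I_k2 -> A) : pi (\sum_i u i *: y i) = \sum_i u i *: pi (y i).
  rewrite (big_morph pi (quotmod_piD W) (quotmod_pi0 _)).
  by apply: eq_bigr => i _; exact: quotmod_piZ.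
have BN : subquotient_basis m (colon m aN) aN (pi \o y).
  split=> [i|X XS|u].
  - apply/colonE => c cm; have /preimE := iffLR (colonE _ _ _) (yS i) c cm.
    by rewrite quotmod_piZ.
  - have [x xE] := quotmod_pi_surj X; have [|u /preimE uE] := yG x.
      by apply/colonE => c cm; apply/preimE; rewrite quotmod_piZ -xE; apply: (iffLR (colonE _ _ _) XS).
    exists u; rewrite xE; move: uE.
    by rewrite -scaleN1r quotmod_piD quotmod_piZ piS scaleN1r.
  - by rewrite -piS => /preimE/yI.
have /choice[x xP] i : exists x, x \in colon m aV /\ y i - x \in U'.
  by have [x ? ?] := socle_lift (yS i); exists x.
have Bx : subquotient_basis m (colon m U') U' x.
  have subx (u : 'I_k2 -> A) : \sum_i u i *: y i - \sum_i u i *: x i \in U'.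
    rewrite -sumrB; apply: rpred_sum => i _; rewrite -scalerBr; apply: rpredZ.
    by case: (xP i).
  split=> [i|z /yG[u uU]|u uU].
  - by have [/colonE xS _] := xP i; apply/colonE => c /xS/aV_U'.
  - exists u; have := rpredD uU (subx u); by rewrite addrA subrK.
  - by apply: yI; apply: (submodBr (subx u)).
have := basis_cat B1 Bx (fun i => (xP i).1).
rewrite (socle_dimE A_local B1) /module_type (depth_eq1 A_local N_fg N_neq0 am a_reg N_cof).
rewrite (Ext1_dimE A_local am a_reg BN) => -[eS eG eI].
have colE z : (z \in colon m (mulmod q (full V))) <-> (z \in colon m aV).
  by rewrite !colonE; split=> H c /H; rewrite qV_E.
apply: (index_of_reducibilityE A_local filtr (e := _)); split.
- by move=> i; apply/colE; exact: eS i.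
- by move=> z /colE/eG[u uE]; exists u; rewrite qV_E.
- by move=> u; rewrite qV_E; apply: eI.
Qed.

End IndexFormula.

(** * The bound for a module of dimension one *)

Section ParameterIdeals.
Variables (A : comNzRingType) (m : ideal A).
Hypotheses (A_noetherian : noetherian A) (A_local : local_ring m).
Variable V : lmodType A.
Hypotheses (V_fg : finitely_generated V) (V_dim : has_dim V 1).
Local Notation W := (H0 V m).

(** If [V = W], some [m^n] kills [V] and lies in the prime [P 0]; then [m], and with it [P 1], lies
    in [P 0]. *)
Lemma dim1_neq_H0 : exists x : V, x \notin W.
Proof.
apply: contrapT => H; have VW (x : V) : x \in W.
  by apply/negPn/negP => xW; apply: H; exists x.
case: V_fg => s Vs.
have [n ns] : exists n, {in s, forall x, forall c, c \in ideal_pow m n -> c *: x = 0}.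
  elim: (s) => [|x s' [n ns]]; first by exists 0%N.
  have /H0P[p px] := VW x; exists (p + n)%N => y; rewrite inE => /orP[/eqP-> c cm|ys c cm].
    by apply: px; apply: ideal_pow_le cm; apply: leq_addr.
  by apply: (ns _ ys); apply: ideal_pow_le cm; apply: leq_addl.
have nV c (x : V) : c \in ideal_pow m n -> c *: x = 0.
  move=> cm; have : x \in span s by rewrite -Vs.
  have cl : prop_submod_closed (fun x : V => c *: x = 0).
    split=> [|u v u0 v0|d u u0]; first by rewrite scaler0.
      by rewrite scalerDr u0 v0 addr0.
    by rewrite scalerA mulrC -scalerA u0 scaler0.
  move=> xs; apply/(prop_submodE cl); apply: span_sub xs => y ys.
  by apply/(prop_submodE cl); apply: ns.
case: V_dim => -[P [prP annP stP]] _.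
have [_ [c cP1 /negP cP0]] := stP 0%N isT; apply: cP0.
have [_ P0p] := prP 0%N isT; have [P1p _] := prP 1%N isT.
have cm : c \in m by apply: (local_sub A_local P1p).
have : c ^+ n \in P 0%N by apply: annP => x; apply: nV; apply: ideal_pow_exp.
have [P00 _] := prP 0%N isT.
elim: n {ns nV} => [|n IH]; first by move: P00; rewrite /proper expr0 => /negP.
by rewrite exprS => /P0p/orP[|/IH].
Qed.

Lemma parameter_principal (q : ideal A) : parameter_ideal q V ->
  exists2 a : A, q =i span [:: a : A^o] & a \in m.
Proof.
move=> [qp _ [d [dchain dmax] [s qs]]].
have d1 : d = 1%N.
  by case: V_dim => c1 max1; apply/eqP; rewrite eqn_leq max1 // dmax.
move: s qs; rewrite d1 => -[[|a [|]]] //= _ qa; exists a => //.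
by apply: (local_sub A_local qp); rewrite qa mem_span ?mem_head.
Qed.

Section Bound.
Variables (b : A) (t u : nat).
Hypotheses (bm : b \in m)
  (tV : forall c (x : V), c \in ideal_pow m t -> c *: x \in dilate b (full V)).
Hypotheses (uW : forall x : V, x \in W -> forall c, c \in ideal_pow m u -> c *: x = 0)
  (regW : forall x : V, b *: x \in W -> x \in W).

Lemma mulmod_pow_cap_H0 (x : V) :
  x \in mulmod (ideal_pow m (t * u)) (full V) -> x \in W -> x = 0.
Proof.
move=> xm; apply: (dilate_cap_H0 bm uW regW).
by apply: mulmod_sub xm => c y cm _; exact: (pow_dilate tV y cm).
Qed.

(** The exponent [n.+1] gives [a z = b^(n+1) z']; after [b] is cancelled, [v = b^n z'] is still in
    [m^n V]. *)
Lemma socle_in_pow n (a : A) (y : V) : a \in ideal_pow m (t * n.+1) ->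
  (forall c, c \in m -> exists z, c *: y - a *: z \in W) ->
  exists2 v, v \in mulmod (ideal_pow m n) (full V) & y - v \in W.
Proof.
move=> am /(_ b bm)[z zW].
have /dilateE[z' _ E] := pow_dilate tV z am.
exists (b ^+ n *: z'); first by apply: mulmod_mem => //; apply: ideal_pow_exp.
by apply: regW; rewrite scalerBr scalerA -exprS -E.
Qed.

End Bound.

Lemma index_formula_eventually : exists l : nat, forall q : ideal A,
  parameter_ideal q V -> {subset q <= ideal_pow m l} ->
  index_of_reducibility q V = (socle_dim m V + module_type m (quotmod W))%N.
Proof.
(* One fixed parameter ideal provides the [b] that serves all [q]; if there is none, every [l]
   works. *)
have [[q0 q0P]|H] := pselect (exists q, parameter_ideal q V); last first.
  by exists 0%N => q qP; case: H; exists q.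
have [b q0b bm] := parameter_principal q0P; case: q0P => _ q0cof _.
have [t [C filtr]] := finite_length_filtration q0cof.
have tV c (x : V) : c \in ideal_pow m t -> c *: x \in dilate b (full V).
  by move=> cm; rewrite -(mulmod_span1E _ q0b); exact: (filtration_pow A_local x filtr cm).
have [[u uW] regW] := H0_uniform A_noetherian V_fg bm tV.
(* [n = t u] puts [m^n V] inside [b^u V], which meets [W] trivially because [b^u] kills [W] and [b]
   is regular modulo [W]. *)
pose n := (t * u)%N; exists (t * n.+1)%N => q qP ql.
have [a qa am] := parameter_principal qP; case: qP => _ qcof _.
have aml : a \in ideal_pow m (t * n.+1) by apply: ql; rewrite qa mem_span ?mem_head.
apply: (index_formula A_noetherian A_local (n := n) V_fg dim1_neq_H0 qa am qcof).
- exact: mulmod_pow_cap_H0 bm tV uW regW.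
- by move=> y; apply: (socle_in_pow bm tV regW).
- apply: ideal_pow_le aml; rewrite /n; case: (t) => // t'.
  exact: leq_trans (leqnSn _) (leq_pmull _ _).
Qed.

End ParameterIdeals.

(** * Growth of the powers of the maximal ideal *)

Section GeneratorBound.
Variables (A : comNzRingType) (m : ideal A).
Hypothesis A_local : local_ring m.

Section Dilation.
Variable V : lmodType A.

Lemma layer_dilate (a : A) (D D' : submodClosed V) :
  layer D D' -> layer (dilate a D) (dilate a D').
Proof.
move=> lay _ _ /dilateE[x xD ->] /dilateE[y yD ->] /negP yD'.
have [|v vD] := lay x y xD yD; first by apply/negP => /(mem_dilate a).
by exists v; rewrite scalerA mulrC -scalerA -scalerBr; apply: mem_dilate.
Qed.

Lemma layer_eql (D1 D2 D' : submodClosed V) : D1 =i D2 -> layer D1 D' -> layer D2 D'.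
Proof. by move=> E lay x y; rewrite -!E; apply: lay. Qed.

(** The filtration from [V] to [aV] is continued by [a] times the one from [V] to [bV]. *)
Lemma filtration_dilate p q (C D : nat -> submodClosed V) (a b : A) :
  filtration p C (dilate a (full V)) -> filtration q D (dilate b (full V)) ->
  filtration (p + q) (fun i => if (i <= p)%N then C i else dilate a (D (i - p)%N))
    (dilate (a * b) (full V)).
Proof.
move=> [C0 Cp Clay] [D0 Dq Dlay].
have CpD : C p =i dilate a (D 0%N).
  by move=> x; rewrite Cp; apply: submod_eqP x => x; rewrite !dilateE;
    split=> -[z _ ->]; exists z; rewrite ?D0.
split=> [//||i ipq].
- have DE : dilate a (D q) =i dilate (a * b) (full V).
    apply: submod_eqP => x; rewrite !dilateE; split=> [[z]|[z _ ->]].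
      by rewrite Dq => /dilateE[y _ ->] ->; exists y; rewrite // scalerA.
    by exists (b *: z); rewrite ?scalerA // Dq; apply: mem_dilate.
  case: leqP => [|_]; last by rewrite addKn.
  rewrite -{2}[p]addn0 leq_add2l leqn0 => /eqP q0 x.
  by rewrite q0 addn0 CpD -DE q0.
- have [ip|pi] := ltnP i p; first by rewrite ltnW //; apply: Clay.
  have lay : layer (dilate a (D (i - p)%N)) (dilate a (D (i.+1 - p)%N)).
    by rewrite subSn //; apply/layer_dilate/Dlay; rewrite ltn_subLR.
  case: leqP => [ip|//]; have <- : p = i by apply/eqP; rewrite eqn_leq pi.
  apply: (layer_eql (D1 := dilate a (D 0%N))); first by move=> x; rewrite CpD.
  by move: lay; have -> : i = p by [apply/eqP; rewrite eqn_leq ip]; rewrite subnn.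
Qed.

Lemma filtration_exp p (C : nat -> submodClosed V) (a : A) n :
  filtration p C (dilate a (full V)) ->
  exists C', filtration (n * p) C' (dilate (a ^+ n) (full V)).
Proof.
move=> filtr; elim: n => [|n [C' filtr']].
  exists (fun=> full V); split=> // x; apply/esym/dilateE.
  by exists x; rewrite // scale1r.
by eexists; rewrite exprS mulSn; exact: filtration_dilate filtr filtr'.
Qed.

End Dilation.

(* The length of [A / m ^ n] is at most that of [A / a ^ n A], hence at most [n p];
   so [m ^ N / m ^ N.+1] has dimension at most [p] for infinitely many [N]. *)
Lemma ideal_pow_gens_bound p (C : nat -> ideal A) (a : A) n1 :
  a \in m -> filtration p C (dilate a (full A^o)) ->
  exists N, (n1 <= N)%N /\ forall z : 'I_p.+1 -> A^o,
    (forall i, z i \in ideal_pow m N) -> ~ indep m (ideal_pow m N.+1) z.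
Proof.
move=> am filtr; apply: contrapT => H.
have {}H N : (n1 <= N)%N -> exists z : 'I_p.+1 -> A^o,
    (forall i, z i \in ideal_pow m N) /\ indep m (ideal_pow m N.+1) z.
  move=> nN; apply: contrapT => H'; apply: H; exists N; split=> // z zN zI.
  by apply: H'; exists z.
(* If each of the [j0] steps from [n1] to [n] used [p + 1] gaps, there would be at least
   [j0 (p + 1)] of them, which exceeds [n p] as soon as [j0 > n1 p]. *)
pose j0 := (n1 * p).+1; pose n := (n1 + j0)%N.
have [C' [C0 Cn lay]] := filtration_exp n filtr.
pose g (N : nat) := #|gaps C' (n * p) (ideal_pow m N)|.
have step j : (j <= j0)%N -> (g (n1 + j) + j * p.+1 <= g n1)%N.
  elim: j => [_|j IH jj0]; first by rewrite !addn0.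
  apply: leq_trans (IH (ltnW jj0)); rewrite mulSn addnA leq_add2r.
  have [z [zN zI]] := H (n1 + j)%N (leq_addr _ _); rewrite /g [(n1 + _)%N]addnS.
  apply: (indep_gaps A_local (C := C') _ _ lay _ zN zI) => x.
  - by rewrite C0.
  - rewrite Cn => /dilateE[y _ ->]; apply: (ideal_pow_le (p := n)).
      by rewrite /n -addnS leq_add2l.
    by rewrite -[(_ *: y)%R]/(a ^+ n * y) mulrC; apply/idealMl/ideal_pow_exp.
  - by apply: ideal_pow_le.
have := leq_trans (leq_addl _ _) (leq_trans (step _ (leqnn _)) (card_gaps_le C' (n * p) _)).
by rewrite mulnS mulnDl leq_add2r ltnn.
Qed.

End GeneratorBound.

(** * Existence of principal reductions *)

Section PrincipalReduction.
Variables (A : comNzRingType) (m : ideal A).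
Hypotheses (A_noetherian : noetherian A) (A_local : local_ring m).
Implicit Types J : ideal A.
Local Notation pow := (ideal_pow m).

Lemma mulmod_powS J n (c : A) x :
  c \in m -> x \in mulmod J (pow n) -> c * x \in mulmod J (pow n.+1).
Proof.
move=> cm xJ.
have cl : prop_submod_closed (fun x : A^o => c * x \in mulmod J (pow n.+1)).
  split=> [|u v Hu Hv|d u Hu]; first by rewrite mulr0; apply: rpred0.
    by rewrite mulrDr; apply: rpredD.
  by rewrite -[(d *: u)%R]/((d : A) * u) mulrCA; apply: idealMl.
apply/(prop_submodE cl); apply: mulmod_sub xJ => d y dJ yn; apply/(prop_submodE cl).
rewrite -[(d *: y)%R]/((d : A) * y) mulrCA; apply: (mulmod_mem (V := A^o)) => //.
exact: ideal_powS.
Qed.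

Lemma power_relationP J n : {subset J <= m} ->
  {subset pow n.+1 <= mulmod J (pow n)} -> power_relation J m n.
Proof. by move=> Jm H x; apply/idP/idP => [/H//|]; apply: mulmodS. Qed.

Lemma power_relation_le J n j : {subset J <= m} -> (n <= j)%N ->
  power_relation J m n -> power_relation J m j.
Proof.
move=> Jm /subnK <- Hn; elim: (j - n)%N => // i IH; apply: power_relationP => //.
apply: mulmod_sub => c y cm; rewrite addSn IH; exact: mulmod_powS.
Qed.

Lemma pow_nakayama N (K : ideal A) :
  (forall x, x \in pow N -> exists2 y, y \in pow N.+1 & x - y \in K) ->
  {subset pow N <= K}.
Proof.
move=> H; have [s sE] := A_noetherian (pow N).
have sub : {subset span s <= K}.
  apply: (nakayama A_local) => x; rewrite -sE => /H[y yN yK]; exists y => //.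
  by apply: mulmodS yN => // z; rewrite sE.
by move=> x; rewrite sE; apply: sub.
Qed.

Lemma reduction_eq J J' : J =i J' -> reduction J m -> reduction J' m.
Proof.
move=> E [Jm [n Hn]]; split=> [x|]; first by rewrite -E; apply: Jm.
exists n; apply: power_relationP => [x|x]; first by rewrite -E; apply: Jm.
by rewrite Hn; apply: mulmodS => // y; rewrite E.
Qed.

Section Pencil.
Variables (B : nat) (lam : nat -> A).
Hypothesis lam_diff : forall i j, i != j -> lam i - lam j \notin m.
Hypothesis pow_bound : forall n1, exists N, (n1 <= N)%N /\ forall z : 'I_B.+1 -> A^o,
  (forall i, z i \in pow N) -> ~ indep m (pow N.+1) z.

(* If none of the [b1 - lam i * b2 :: s] spans a reduction, then for large [N] the
   power [m ^ N] contains, for each [i], a multiple of the product of the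
   [b1 - lam j * b2], [j != i], that is nonzero modulo [b1 - lam i * b2 :: s]; these
   are linearly independent modulo [m ^ N.+1], in contradiction with the bound. *)
Lemma reduction_drop_gen (b1 b2 : A) (s : seq A^o) :
  reduction (span (b1 :: b2 :: s : seq A^o)) m ->
  exists c, reduction (span (b1 - c * b2 :: s : seq A^o)) m.
Proof.
set J := span _ => -[Jm [n0 n0P]]; apply: contrapT => H.
have b1m : b1 \in m by apply: Jm; apply: mem_span; rewrite mem_head.
have b2m : b2 \in m by apply: Jm; apply: mem_span; rewrite !in_cons eqxx orbT.
have sm : {subset span s <= m}.
  by apply: span_sub => y ys; apply/Jm/mem_span; rewrite !in_cons ys !orbT.
pose bb i := b1 - lam i * b2; pose JJ i := span (bb i :: s : seq A^o).
have bbm i : bb i \in m by apply: submodB => //; apply: idealMl.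
have JJm i : {subset JJ i <= m}.
  by apply: span_sub => y; rewrite in_cons => /orP[/eqP->//|/mem_span/sm].
have bbJ i : bb i \in JJ i by apply: mem_span; rewrite mem_head.
(* Since [lam i - lam k] is a unit, [b1] and [b2] are combinations of [bb i] and [bb k], so that [J]
   lies in [JJ i + A bb k]. *)
have step i k j x : i != k -> (n0 <= j)%N -> x \in pow j.+1 ->
    exists2 y, y \in pow j & x - bb k * y \in mulmod (JJ i) (pow j).
  move=> ik n0j; rewrite (power_relation_le Jm n0j n0P) => xJ.
  have cl : prop_submod_closed (fun x : A^o =>
      exists2 y : A, y \in pow j & (x : A) - bb k * y \in mulmod (JJ i) (pow j)).
    split=> [|u v [y yj uJ] [y' yj' vJ]|d u [y yj uJ]].
    - by exists 0; rewrite ?mulr0 ?subr0; apply: rpred0.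
    - by exists (y + y'); [apply: rpredD | rewrite mulrDr opprD addrACA; apply: rpredD].
    - exists ((d : A) * y); first exact: idealMl.
      by rewrite -[(d *: u)%R]/((d : A) * u) mulrCA -mulrBr; apply: idealMl.
  apply/(prop_submodE cl); apply: mulmod_sub xJ => d y /span_consP[al].
  move=> /span_consP[be ss] yj; apply/(prop_submodE cl).
  have [e eE] := local_unit A_local (lam_diff ik).
  set si := _ - be *: _ in ss.
  pose ga := (al * lam i + be) * e; exists (ga * y); first exact: idealMl.
  have Ek : ga * bb k = ga * bb i + (al * lam i + be) * b2.
    have -> : bb k = bb i + (lam i - lam k) * b2 by rewrite /bb mulrBl addrA subrK.
    have gaE : ga * (lam i - lam k) = al * lam i + be by rewrite /ga -mulrA eE mulr1.
    by rewrite mulrDr [ga * (_ * b2)]mulrA gaE.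
  have Ed : (d : A) = si + al * bb i + (al * lam i + be) * b2.
    rewrite -addrA (_ : al * bb i + _ = be * b2 + al * b1); last first.
      by rewrite /bb mulrBr mulrA mulrDl addrA subrK addrC.
    rewrite /si -[al *: (b1 : A^o)]/(al * b1) -[be *: (b2 : A^o)]/(be * b2).
    by rewrite addrA !subrK.
  have -> : d *: y - bb k * (ga * y) = (si + (al - ga) * bb i) * y.
    rewrite -[(d *: y)%R]/((d : A) * y) mulrA -mulrBl [bb k * _]mulrC Ek Ed.
    by rewrite [ga * _ + _]addrC addrKA [(al - ga) * _]mulrBl addrA.
  apply: (mulmod_mem (V := A^o)) => //; apply: rpredD; last exact: idealMl.
  by apply: (span_sub _ ss) => w ws; apply: mem_span; rewrite in_cons ws orbT.
have iter i (ks : seq nat) j x : i \notin ks -> (n0 <= j)%N ->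
    x \in pow (j.+1 + size ks) ->
    exists2 w, w \in pow j.+1 &
      x - (\prod_(k <- ks) bb k) * w \in mulmod (JJ i) (pow (j + size ks)).
  elim: ks x => [|k ks IH] x.
    by rewrite addn0 => _ _ xj; exists x; rewrite // big_nil mul1r subrr; apply: rpred0.
  rewrite in_cons negb_or => /andP[ik iks] n0j /=; rewrite !addnS => xj.
  have n0k : (n0 <= (j + size ks).+1)%N by rewrite -addnS; apply: leq_trans n0j (leq_addr _ _).
  have [y yj xy] := step i k (j + size ks).+1 x ik n0k xj.
  have [w wj yw] := IH y iks n0j yj; exists w => //; rewrite big_cons.
  have -> : x - bb k * \prod_(k0 <- ks) bb k0 * w =
    (x - bb k * y) + bb k * (y - (\prod_(k0 <- ks) bb k0) * w).
    by rewrite mulrBr mulrA addrA subrK.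
  by apply: rpredD => //; apply: mulmod_powS.
have prod_pow (ks : seq nat) : \prod_(k <- ks) bb k \in pow (size ks).
  elim: ks => [|k ks IH]; first by rewrite big_nil.
  by rewrite big_cons; apply: ideal_powS.
have [N [Nn0 Nbound]] := pow_bound (n0 + B.+2)%N.
pose j := (N - B.+1)%N.
have BN : (B.+1 <= N)%N by apply: leq_trans Nn0; rewrite addnS leqW // leq_addl.
have n0j : (n0 <= j)%N.
  by rewrite leq_subRL //; apply: leq_trans Nn0; rewrite addnC leq_add2l.
have NE : N = (j + B.+1)%N by rewrite subnK.
pose ks i := rem i (iota 0 B.+1).
have size_ks i : (i < B.+1)%N -> size (ks i) = B.
  by move=> iB; rewrite size_rem ?size_iota // mem_iota.
have ks_mem i k : (k \in ks i) = (k != i) && (k < B.+1)%N.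
  by rewrite mem_rem_uniq ?iota_uniq //; rewrite !ssrbool.inE mem_iota.
(* Otherwise [iter] gives [m^N] inside [JJ i m^(N-1) + m^(N+1)], and Nakayama's lemma makes [JJ i] a
   reduction. Here [j + B = N - 1]. *)
have /choice[w wP] (i : 'I_B.+1) : exists w, w \in pow j.+1 /\
    forall t, t \in pow N.+1 ->
      (\prod_(k <- ks i) bb k) * w - t \notin mulmod (JJ i) (pow (j + B)).
  apply: contrapT => H'; apply: H; exists (lam i); split; first exact: (JJm i).
  exists (j + B)%N; apply: power_relationP; first exact: (JJm i).
  rewrite -addnS -NE; apply: pow_nakayama => x; rewrite {1}NE addnS -addSn => xN.
  have := iter i (ks i) j x; rewrite size_ks // ks_mem eqxx => /(_ isT n0j xN)[w wj xw].
  apply: contrapT => H''; apply: H'; exists w; split=> // t tN; apply/negP => wt.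
  by apply: H''; exists t => //; have := rpredD xw wt; rewrite addrA subrK.
pose z (i : 'I_B.+1) : A^o := (\prod_(k <- ks i) bb k) * w i.
apply: (Nbound z) => [i|u uN i].
  rewrite NE -addSnnS addnC; apply: ideal_powM; last by case: (wP i).
  by have := prod_pow (ks i); rewrite size_ks.
apply/negPn/negP => /(local_unit A_local)[e eu].
(* For [k != i] the product in [z k] contains [bb i], so [z k] is in [JJ i m^(N-1)]; a unit
   coefficient on [z i] would put [z i] in [JJ i m^(N-1) + m^(N+1)]. *)
have [_ /(_ (e * \sum_k u k *: z k))] := wP i.
move=> /(_ (idealMl _ uN))/negP; apply; rewrite -/(z i).
have -> : z i - e * \sum_k u k *: z k = - e * \sum_(k < B.+1 | k != i) u k *: z k.
  rewrite (bigD1 i) //= mulrDr mulNr opprD addrA -[(u i *: z i)%R]/(u i * z i).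
  by rewrite mulrA eu mul1r subrr sub0r.
apply: idealMl; apply: rpred_sum => k ki; apply: rpredZ.
have ik : (i : nat) \in ks k by rewrite ks_mem ltn_ord andbT eq_sym.
rewrite /z (big_rem _ ik) /= -mulrA; apply: (mulmod_mem (V := A^o)) => //.
have -> : (j + B)%N = (size (rem (i : nat) (ks k)) + j.+1)%N.
  have B0 : (0 < B)%N by rewrite -(size_ks k (ltn_ord k)); case: (ks k) ik.
  by rewrite size_rem // size_ks // -addSnnS prednK // addnC.
by apply: ideal_powM; [exact: prod_pow | case: (wP k)].
Qed.

Lemma reduction_principal (s : seq A^o) : reduction (span s) m ->
  exists2 b, b \in span s & reduction (span [:: b]) m.
Proof.
have [n] := ubnP (size s); elim: n s => // n IH [|b1 [|b2 s]] sn red.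
- exists 0; first exact: rpred0.
  apply: reduction_eq red => x; apply/idP/idP => [|/span1P[c ->]].
    by move=> /spanP[c ->]; rewrite big_ord0; apply: rpred0.
  by rewrite scaler0; apply: rpred0.
- by exists b1; first by apply: mem_span; rewrite mem_head.
- have [c redc] := reduction_drop_gen red.
  have [//|b bs redb] := IH _ _ redc; exists b => //.
  apply: span_sub bs => y; rewrite in_cons => /orP[/eqP->|ys].
    apply: submodB; first by apply: mem_span; rewrite mem_head.
    by apply: idealMl; apply: mem_span; rewrite !in_cons eqxx orbT.
  by apply: mem_span; rewrite !in_cons ys !orbT.
Qed.

End Pencil.
End PrincipalReduction.

Lemma leastP (P : nat -> Prop) : (exists n, P n) -> P (least P).
Proof.
move=> [n0 Pn0]; have Pex : exists n, `[< P n >] by exists n0; apply/asboolP.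
case: (ex_minnP Pex) => n /asboolP Pn nmin.
pose S := [set n | P n /\ forall k, P k -> (n <= k)%N]%classic.
by have [] : S (least P) by apply: (@xgetI _ _ S n); split=> // k Pk; apply/nmin/asboolP.
Qed.

(** * The explicit bound for the ring *)

Section ReductionNumber.
Variables (A : comNzRingType) (m : ideal A).
Hypotheses (A_noetherian : noetherian A) (A_local : local_ring m).
Hypotheses (A_dim : has_dim A^o 1) (k_infinite : infinite_set [set: residue_field m]).
Local Notation pow := (ideal_pow m).
Local Notation W := (H0 A^o m).

Lemma residue_reps : exists lam : nat -> A,
  forall i j : nat, i != j -> lam i - lam j \notin m.
Proof.
have /infiniteP/card_leP[f] := k_infinite.
pose g (i : nat) : residue_field m := \val (f (SigSub (mem_setT i))).
have /choice[lam lamE] i : exists c : A, quotmod_pi m c = g i.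
  by have [c ->] := quotmod_pi_surj (g i); exists c.
exists lam => i j; apply: contra_neqN => /(quotmod_piP m); rewrite !lamE => /val_inj.
by move=> /(@inj _ _ _ f _ _ (mem_setT _) (mem_setT _)) /(congr1 val).
Qed.

Lemma ring_fg : finitely_generated A^o.
Proof.
exists [:: 1 : A^o] => x; apply/esym/span1P; exists (x : A).
by rewrite -[(x : A) *: _]/((x : A) * 1) mulr1.
Qed.

Lemma mulmod_full J : mulmod J (full A^o) =i J.
Proof.
apply: submod_eqP => x; split.
  by apply: mulmod_sub => c y cJ _; rewrite -[(c *: y)%R]/((c : A) * y) mulrC; apply: idealMl.
by move=> xJ; rewrite -[x](mulr1 (x : A)); apply: (mulmod_mem (V := A^o)).
Qed.

Lemma pow_neq0 n : exists2 x, x \in pow n & x != 0.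
Proof.
have [x0 /negP x0W] := dim1_neq_H0 A_local ring_fg A_dim.
apply: contrapT => H; apply: x0W; apply/H0P; exists n => c cn.
have -> : c = 0 by apply/eqP/negPn/negP => c0; apply: H; exists c.
by rewrite scale0r.
Qed.

Section Principal.
Hypothesis principal : forall s : seq A^o, reduction (span s) m ->
  exists2 b, b \in span s & reduction (span [:: b]) m.

(** A smaller reduction contains a principal one, generated by some [u b]. If [u] were in [m], then
    [m^(n+1) = u b m^n] would lie in [m^(n+2)], so [m^(n+1) = 0] by Nakayama's lemma, which
    dimension one forbids. *)
Lemma principal_reduction_minimal (b : A^o) :
  reduction (span [:: b]) m -> minimal_reduction (span [:: b]) m.
Proof.
move=> redb; split=> // J redJ Jb x; apply/idP/idP; first exact: Jb.
have [s sE] := A_noetherian J.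
have [b' b's [b'm [n redb']]] := principal (reduction_eq sE redJ).
have /span1P[u uE] : b' \in span [:: b] by apply: Jb; rewrite sE.
have um : u \notin m.
  apply/negP => um; have [y yn y0] := pow_neq0 n.+1.
  have sub : {subset pow n.+1 <= zero_submod A^o}.
    apply: (pow_nakayama A_noetherian A_local) => z zn; exists z; last by rewrite subrr rpred0.
    move: zn; rewrite redb'; apply: mulmod_sub => c w /span1P[d ->] wn.
    rewrite uE -[(_ *: w)%R]/((d * (u * b) : A) * w) mulrCA -!mulrA.
    apply: (ideal_powS (n := n.+1)) => //; apply: idealMl; apply: ideal_powS => //.
    by apply: redb.1; apply: mem_span; rewrite mem_head.
  by case/negP: y0; apply/eqP/zero_submodE/sub.
have bJ : b \in J.
  by apply: (scale_unit (V := A^o) A_local um); rewrite -uE sE.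
by apply: span_sub => z; rewrite inE => /eqP->.
Qed.

(** [least] returns [0] on an empty set, so a minimal reduction must be exhibited before [red m] is
    known to be attained. The reduction attaining it contains a principal reduction and equals it by
    minimality. *)
Lemma red_principal : exists2 b : A, b \in m &
  power_relation (span [:: b : A^o]) m (red m).
Proof.
have [s sE] := A_noetherian m.
have redm : reduction m m by split=> //; exists 0%N.
have [b0 _ /principal_reduction_minimal minb0] := principal (reduction_eq sE redm).
have [J [redJ minJ] <-] : exists2 J, minimal_reduction J m & red_wrt J m = red m.
  by apply: (@leastP (fun n => exists2 J, minimal_reduction J m & red_wrt J m = n));
     eexists; exists (span [:: b0]).
have rel : power_relation J m (red_wrt J m) by apply: leastP; case: redJ.
have [sJ sJE] := A_noetherian J.
have [b bs redb] := principal (reduction_eq sJE redJ).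
have bJ : span [:: b] =i J.
  by apply: minJ => //; apply: span_sub => y; rewrite inE => /eqP->; rewrite sJE.
exists b; first by apply: redJ.1; rewrite sJE.
apply: power_relationP => [x|x]; first by rewrite bJ; apply: redJ.1.
by rewrite rel; apply: mulmodS => // y; rewrite bJ.
Qed.

End Principal.

Lemma index_formula_ring (q : ideal A) :
  let d := least (fun n : nat => forall x : A, x \in pow n -> x \in W -> x = 0) in
  parameter_ideal q A^o -> {subset q <= pow (maxn (red m) d).+1} ->
  index_of_reducibility q A^o = (socle_dim m A^o + module_type m (quotmod W))%N.
Proof.
move=> d qP qpow; set n := maxn _ d in qpow.
have [a qa am] := parameter_principal A_local A_dim qP; case: qP => _ qcof _.
have [p [C filtr]] := finite_length_filtration qcof.
have filtr_a : filtration p C (dilate a (full A^o)).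
  by case: filtr => C0 Cp lay; split=> // x; rewrite Cp (mulmod_span1E _ qa).
have [lam lamP] := residue_reps.
have [b bm redb] := red_principal (reduction_principal A_noetherian A_local lamP
  (fun n1 => ideal_pow_gens_bound A_local n1 am filtr_a)).
(* That [d] has its defining property requires some power of [m] to meet [W] trivially; the
   parameter [a] provides one. *)
have dP : forall x : A, x \in pow d -> x \in W -> x = 0.
  apply: (@leastP (fun n : nat => forall x : A, x \in pow n -> x \in W -> x = 0)).
  have a_cof c (x : A^o) : c \in pow p -> c *: x \in dilate a (full A^o).
    by move=> cm; exact: (filtration_pow A_local x filtr_a cm).
  have [[u uW] regW] := H0_uniform A_noetherian ring_fg am a_cof.
  exists (p * u)%N => x xp; apply: (mulmod_pow_cap_H0 am a_cof uW regW).
  by rewrite mulmod_full.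
(* This makes [b] regular on [A / W], so that it can be cancelled below. *)
have b_cof c (x : A^o) : c \in pow (red m).+1 -> c *: x \in dilate b (full A^o).
  rewrite redb => /(mulmod_span1 _ (fun _ => erefl))[z _ ->].
  by rewrite -scalerA; apply: mem_dilate.
have [_ regW] := H0_uniform A_noetherian ring_fg bm b_cof.
have an : a \in pow n.+1 by apply: qpow; rewrite qa mem_span ?mem_head.
apply: (index_formula A_noetherian A_local (n := n) ring_fg
  (dim1_neq_H0 A_local ring_fg A_dim) qa am qcof).
- move=> x; rewrite mulmod_full => xn; apply: dP.
  by apply: ideal_pow_le xn; apply: leq_maxr.
- move=> y /(_ b bm)[z zW].
  have : a * z \in pow n.+1 by rewrite mulrC; apply: idealMl.
  have bsub : {subset span [:: b : A^o] <= m} by apply: span_sub => x; rewrite inE => /eqP->.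
  (* As [n >= c], [m^(n+1) = b m^n], so [a z = b v] with [v] in [m^n]; [v] represents the socle
     element. *)
  have -> := power_relation_le bsub (leq_maxl _ d) redb.
  move=> /(mulmod_span1 _ (fun _ => erefl))[v vn azE]; exists v.
    by rewrite mulmod_full.
  by apply: regW; rewrite scalerBr -azE.
- by apply: ideal_pow_le an.
Qed.

End ReductionNumber.

Theorem theorem2p3 (A : comNzRingType) (m : ideal A)
    (A_noetherian : noetherian A) (A_local : local_ring m) :
  (forall M : lmodType A, finitely_generated M -> has_dim M 1 ->
     exists l : nat, forall q : ideal A,
       parameter_ideal q M -> {subset q <= ideal_pow m l} ->
       index_of_reducibility q M
       = (socle_dim m M + module_type m (quotmod (H0 M m)))%N)
  /\
  (has_dim A^o 1 ->
   infinite_set [set: residue_field m] ->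
   let W := H0 A^o m in
   let c := red m in
   let d := least (fun n : nat =>
     forall x : A, x \in ideal_pow m n -> x \in W -> x = 0) in
   forall q : ideal A,
     parameter_ideal q A^o -> {subset q <= ideal_pow m (maxn c d).+1} ->
     index_of_reducibility q A^o
     = (socle_dim m A^o + module_type m (quotmod W))%N).
Proof.
split=> [M M_fg M_dim|A_dim k_inf W c d q]; first exact: index_formula_eventually.
exact: index_formula_ring.
Qed.
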